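(* Let $\{s_k\}_{k\in\mathbb{N}_0}$ be a positive sequence, let $d\in\mathbb{N}$ (so $d\ge 1$) and $\ell_0\in 2\mathbb{N}_0$, and let $\{\tilde s_k\}_{k\in\mathbb{N}_0}$ be given by $\tilde s_k=s_{kd+\ell_0}$. If $\{s_k\}$ is indeterminate, then $\{\tilde s_k\}$ is indeterminate. Equivalently, if $\{\tilde s_k\}$ is determinate, then $\{s_k\}$ is determinate.
   Context: A sequence of real numbers $\{s_k\}_{k\in\mathbb{N}_0}$ is called positive if for every $n$ the Hankel matrix $(s_{i+j})_{i,j=0}^n$ is positive semidefinite; equivalently there exists a non-decreasing function $\sigma$ on $\mathbb{R}$ (a moment solution) with $s_k=\int_{-\infty}^\infty x^k\,d\sigma(x)$ for all $k\in\mathbb{N}_0$. Two non-decreasing functions are not considered distinct if their difference is constant at all points of continuity of the difference. A positive sequence is determinate if it has exactly one moment solution (in this sense), and indeterminate otherwise. (It is known, by a theorem of Berg–Chen–Ismail, that a positive sequence is determinate iff the smallest eigenvalue of $(s_{i+j})_{i,j=0}^n$ tends to $0$ as $n\to\infty$.) *)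

(* Defs.v *)
From Stdlib Require Import Reals Lra Lia.
Open Scope R_scope.

Fixpoint rsum (g : nat -> R) (n : nat) : R :=
  match n with O => 0 | S m => rsum g m + g m end.

(* A sequence is positive iff every Hankel matrix (s_{i+j})_{i,j=0}^n is
   positive semidefinite (quadratic form written out). *)
Definition positive_seq (s : nat -> R) : Prop :=
  forall (n : nat) (c : nat -> R),
    0 <= rsum (fun i => rsum (fun j => c i * c j * s (i + j)%nat) (S n)) (S n).

Definition nondecreasing (sigma : R -> R) : Prop :=
  forall x y, x <= y -> sigma x <= sigma y.

Definition tagged_partition (a b : R) (n : nat) (p t : nat -> R) : Prop :=
  p O = a /\ p n = b /\
  (forall i, (i < n)%nat -> p i < p (S i)) /\
  (forall i, (i < n)%nat -> p i <= t i <= p (S i)).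

Definition mesh_lt (n : nat) (p : nat -> R) (delta : R) : Prop :=
  forall i, (i < n)%nat -> p (S i) - p i < delta.

Definition RS_sum (f sigma : R -> R) (n : nat) (p t : nat -> R) : R :=
  rsum (fun i => f (t i) * (sigma (p (S i)) - sigma (p i))) n.

Definition RS_integral (f sigma : R -> R) (a b I : R) : Prop :=
  forall eps, 0 < eps -> exists delta, 0 < delta /\
    forall n p t, tagged_partition a b n p t -> mesh_lt n p delta ->
      Rabs (RS_sum f sigma n p t - I) < eps.

Definition RS_integral_R (f sigma : R -> R) (I : R) : Prop :=
  forall eps, 0 < eps -> exists M, forall a b, a <= - M -> M <= b ->
    exists J, RS_integral f sigma a b J /\ Rabs (J - I) < eps.

Definition moment_solution (s : nat -> R) (sigma : R -> R) : Prop :=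
  nondecreasing sigma /\ forall k, RS_integral_R (fun x => x ^ k) sigma (s k).

Definition same_solution (s1 s2 : R -> R) : Prop :=
  exists c, forall x, continuity_pt (fun y => s1 y - s2 y) x -> s1 x - s2 x = c.

Definition determinate (s : nat -> R) : Prop :=
  positive_seq s /\
  (exists sigma, moment_solution s sigma) /\
  (forall s1 s2, moment_solution s s1 -> moment_solution s s2 -> same_solution s1 s2).

Definition indeterminate (s : nat -> R) : Prop :=
  positive_seq s /\ ~ determinate s.

(* Main.v *)
(* Let [L] be the functional on polynomials with [L (X ^ k) = s k].

   Chebyshev-Markov-Stieltjes.  If [p] is a polynomial with [p(t) = 1], there are
   polynomials [V <= 1_(-oo, t[ <= 1_(-oo, t] <= U] with [U - V <= p ^ 2]: first replace
   [p] by a real-rooted polynomial of smaller modulus and with the same value at [t] (for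
   a pair of complex roots this is the Cauchy-Schwarz inequality), then take for [U] and
   [V] Hermite interpolants of the step at the double roots.  Hence the values at [t] of
   two suitably normalised solutions of the moment problem differ by at most [L (p ^ 2)].
   If [s] is indeterminate, this gives [c > 0] and an interval of [t] with
   [c p(t) ^ 2 <= L (p ^ 2)] for all [p].

   Applied to [X ^ (l0 / 2) q (X ^ d)], this bound passes to the sequence
   [s (k d + l0)], at the points [w = t ^ d].  It says that removing an atom of mass [c'] at
   [w] leaves a positive sequence; by Hamburger's theorem some solution then has mass at
   least [c'] at [w].  A single solution cannot do so for a whole interval of [w].

   Hamburger's theorem itself is obtained by extending [L], by Hahn-Banach, to a positive
   functional on all functions of polynomial growth and evaluating it on indicators of
   half-lines. *)
Require Import Defs.
From Stdlib Require Import Reals Lra Lia Classical.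
From mathcomp Require all_boot all_order all_algebra complex polyrcf.
From mathcomp Require boolp classical_sets functions reals Rstruct ring lra.

(** * Polynomials over a real closed field *)

Module RealPolynomials.

Import all_boot all_order all_algebra complex polyrcf ring lra.
Import Order.TTheory GRing.Theory Num.Theory.
Set Implicit Arguments. Unset Strict Implicit. Unset Printing Implicit Defensive.
Local Open Scope ring_scope.

(** A root [a + ib] over the algebraic closure yields the factor. If [b != 0], the remainder modulo
    [(X - a)^2 + b^2] has degree at most one and vanishes at [a + ib]; the imaginary part of its
    value there is [b] times its linear coefficient, so it is zero. *)
Lemma real_poly_factor (R : rcfType) (p : {poly R}) : (1 < size p)%N ->
  exists (a b : R) (q : {poly R}), (size q < size p)%N /\ (p = ('X - a%:P) * q \/
    p = (('X - a%:P) ^+ 2 + (b ^+ 2)%:P) * q /\ b != 0).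
Proof.
move=> sp.
have p0 : p != 0 by rewrite -size_poly_gt0 (ltn_trans _ sp).
have /closed_rootP[[a b] rz] : size (map_poly (real_complex R) p) != 1%N.
  by rewrite size_map_poly -(ltn_predK sp) eqSS -lt0n -ltnS (ltn_predK sp).
exists a, b.
have [b0|b0] := eqVneq b 0.
  have /factor_theorem[q pE] : root p a.
    move: rz; rewrite b0 complexr0 /root horner_map /= => /eqP/complexI ->.
    by rewrite eqxx.
  exists q; split; last by left; rewrite mulrC.
  have q0 : q != 0 by apply: contraNneq p0 => q0; rewrite pE q0 mul0r.
  by rewrite pE size_Mmonic ?monicXsubC // size_XsubC addn2 /= .
set d := ('X - a%:P) ^+ 2 + (b ^+ 2)%:P.
have sd : size d = 3%N.
  rewrite /d size_polyDl size_exp_XsubC //.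
  by rewrite (leq_ltn_trans (size_polyC_leq1 _)).
have d0 : d != 0 by rewrite -size_poly_gt0 sd.
have dz : (map_poly (real_complex R) d).[Complex a b] = 0.
  rewrite /d rmorphD rmorphXn rmorphB /= map_polyX !map_polyC !hornerE /=.
  rewrite expr2 /=; simpc; apply/eqP; rewrite eq_complex /=.
  by apply/andP; split; apply/eqP; ring.
have mz : (map_poly (real_complex R) (p %% d)).[Complex a b] = 0.
  move/eqP: rz; rewrite {1}(divp_eq p d) rmorphD rmorphM /= hornerD hornerM.
  by rewrite dz mulr0 add0r.
have sm : (size (p %% d)%R < 3)%N by rewrite -sd ltn_modp.
have mE : p %% d = (p %% d)`_1 *: 'X + ((p %% d)`_0)%:P.
  apply/polyP => -[|[|i]]; rewrite !coefE /= ?mulr0 ?add0r ?mulr1 ?addr0 //.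
  by rewrite nth_default //; move: sm; rewrite ltnS => /leq_trans; apply.
move: mz; rewrite mE rmorphD /= map_polyZ map_polyX map_polyC !hornerE /=.
simpc => /eqP; rewrite eq_complex /= => /andP[/eqP re /eqP im].
have m1 : (p %% d)`_1 = 0.
  by apply/eqP; move/eqP: im; rewrite mulf_eq0 (negbTE b0) orbF.
have m0 : (p %% d)`_0 = 0 by move: re; rewrite m1 mul0r add0r.
have pE : p = d * (p %/ d) by rewrite {1}(divp_eq p d) mE m0 m1 scale0r !addr0 mulrC.
exists (p %/ d); split; last by right.
by rewrite size_divp // sd ltn_subrL /= (ltn_trans _ sp).
Qed.

Lemma horner_neg_near (R : rcfType) (q : {poly R}) a : q.[a] < 0 ->
  exists2 e : R, 0 < e & forall x, `|x - a| < e -> q.[x] < 0.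
Proof.
move=> qa; have [|e e0 He] := @poly_cont _ a q (- q.[a]); first lra.
exists e => // x /He; rewrite ltr_norml => /andP[_]; lra.
Qed.

(** Induction on the degree: a factor [(X - a)^2 + b^2] is split off, with [b = 0] for a double real
    root, and the cofactor is again nonnegative. *)
Lemma nonneg_poly_sum_squares (R : rcfType) (p : {poly R}) :
  (forall x, 0 <= p.[x]) -> exists f g : {poly R}, p = f ^+ 2 + g ^+ 2.
Proof.
have [n] := ubnP (size p); elim: n p => // n IH p /ltnSE sn p0.
case: (ltnP 1 (size p)) => [sp|/size1_polyC pE]; last first.
  exists (Num.sqrt p`_0)%:P, 0; rewrite expr0n addr0 -rmorphXn /= sqr_sqrtr //.
  by have := p0 0; rewrite pE hornerC coefC.
suff [a [b [q [sq pE]]]] : exists a b (q : {poly R}),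
    (size q < size p)%N /\ p = (('X - a%:P) ^+ 2 + (b ^+ 2)%:P) * q.
  have q0' x : x != a -> 0 <= q.[x].
    move=> xa; have := p0 x; rewrite pE !hornerE /= pmulr_rge0 //.
    by rewrite ltr_wpDr ?sqr_ge0 // lt_def sqr_ge0 expf_eq0 /= subr_eq0 xa.
  (* The factor may vanish at [a]; there the sign of [q] follows by continuity. *)
  have q0 x : 0 <= q.[x].
    have [->|] := eqVneq x a; last exact: q0'.
    rewrite leNgt; apply/negP => /horner_neg_near[e e0 He].
    have := q0' (a + e / 2); have := He (a + e / 2).
    rewrite addrAC subrr add0r gtr0_norm ?divr_gt0 // => H1 H2.
    have : 0 <= q.[a + e / 2].
      by apply: H2; rewrite -subr_eq0 addrAC subrr add0r gt_eqF ?divr_gt0.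
    have : q.[a + e / 2] < 0 by apply: H1; lra.
    lra.
  have [f [g qE]] := IH q (leq_trans sq sn) q0.
  (* Two-square identity: real and imaginary parts of [((X - a) - ib) (f + ig)]. *)
  exists (('X - a%:P) * f + b%:P * g), (('X - a%:P) * g - b%:P * f).
  rewrite pE qE rmorphXn /=; ring.
have [a [b [q [sq [pE|[pE _]]]]]] := real_poly_factor sp; last by exists a, b, q.
(* If [q.[a]] were nonzero, [p = (X - a) q] would change sign at [a]; so the real root is double. *)
have /factor_theorem[r qE] : root q a.
  rewrite /root; case: (ltrgtP q.[a] 0) => // qa.
    have [e e0 He] := horner_neg_near qa.
    have := He (a + e / 2); have := p0 (a + e / 2).
    rewrite pE !hornerE /= addrAC subrr add0r gtr0_norm ?divr_gt0 //.
    move=> H1 H2; have : q.[a + e / 2] < 0 by apply: H2; lra.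
    nra.
  have [|e e0 He] := @horner_neg_near _ (- q) a; first by rewrite hornerN; lra.
  have := He (a - e / 2); have := p0 (a - e / 2).
  rewrite pE !hornerE /= addrAC subrr add0r normrN gtr0_norm ?divr_gt0 //.
  move=> H1 H2; have : - q.[a - e / 2] < 0 by apply: H2; lra.
  nra.
exists a, 0, r; split; last by rewrite pE qE expr0n /= addr0; ring.
have [r0|r0] := eqVneq r 0; first by rewrite r0 size_poly0 (ltn_trans _ sp).
by rewrite (leq_ltn_trans _ sq)// qE size_Mmonic ?monicXsubC // size_XsubC addn2 /=.
Qed.

Lemma real_rooted_minorant (R : rcfType) (p : {poly R}) (t : R) : p.[t] != 0 ->
  exists2 rs : seq R, t \notin rs & forall x,
    `|p.[t]| * `|\prod_(r <- rs) ((x - r) / (t - r))| <= `|p.[x]|.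
Proof.
have [n] := ubnP (size p); elim: n p => // n IH p /ltnSE sn pt.
case: (ltnP 1 (size p)) => [sp|/size1_polyC pE]; last first.
  by exists [::] => // x; rewrite big_nil normr1 mulr1 pE !hornerC.
have [a [b [q [sq [pE|[pE b0]]]]]] := real_poly_factor sp;
  move: pt; rewrite pE !hornerE /= mulf_eq0 negb_or => /andP[ta qt];
  have [rs trs Hrs] := IH q (leq_trans sq sn) qt.
  exists (a :: rs) => [|x].
    by rewrite inE negb_or trs andbT -subr_eq0.
  rewrite big_cons !hornerE /= !normrM.
  have -> : forall u v y z w : R, u * v * (y * z * w) = (u * z) * y * (v * w)
    by move=> *; ring.
  by rewrite normfV mulfV ?normr_eq0 // mul1r ler_wpM2l.
(* If [t = a], the quadratic factor is least at [t] and is replaced by the constant [b ^ 2]. *)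
have [at0|at0] := eqVneq t a.
  exists rs => // x; rewrite !hornerE /= !normrM at0 subrr expr0n /= add0r -mulrA.
  rewrite -at0 ler_pM ?mulr_ge0 ?normr_ge0 // !ger0_norm ?addr_ge0 ?sqr_ge0 //.
  by rewrite lerDr sqr_ge0.
(* Chosen so that [x - r] is proportional to [(x - a) (t - a) + b^2], the inner product of
   [(x - a, b)] and [(t - a, b)]; Cauchy-Schwarz is an equality at [x = t]. *)
pose r := a - b ^+ 2 / (t - a).
have ta0 : t - a != 0 by rewrite subr_eq0.
have Qt : 0 < (t - a) ^+ 2 + b ^+ 2.
  by rewrite ltr_wpDl ?sqr_ge0 // lt_def sqr_ge0 expf_eq0 /= b0.
have tr : t - r = ((t - a) ^+ 2 + b ^+ 2) / (t - a) by rewrite /r; field.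
have tr0 : t - r != 0 by rewrite tr mulf_neq0 ?invr_eq0 // gt_eqF.
exists [:: r, r & rs] => [|x].
  by rewrite !inE !negb_or trs andbT -subr_eq0 tr0.
rewrite !hornerE /= !big_cons; set Q := (t - a) ^+ 2 + b ^+ 2 in Qt tr *.
have -> : (x - r) / (t - r) = ((x - a) * (t - a) + b ^+ 2) / Q.
  by rewrite tr /r; field; rewrite (gt_eqF Qt) ta0.
set k := _ / Q; rewrite [k * (k * _)]mulrA -expr2 normrM [X in _ * X]normrM.
rewrite [X in _ <= X]normrM mulrACA ler_pM ?mulr_ge0 //.
rewrite (gtr0_norm Qt) (ger0_norm (sqr_ge0 k)) ger0_norm ?addr_ge0 ?sqr_ge0 //.
have -> : Q * k ^+ 2 = ((x - a) * (t - a) + b ^+ 2) ^+ 2 / Q.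
  by rewrite /k; field; rewrite gt_eqF.
rewrite ler_pdivrMr // -subr_ge0.
have -> : ((x - a) ^+ 2 + b ^+ 2) * Q - ((x - a) * (t - a) + b ^+ 2) ^+ 2
  = (b * (x - t)) ^+ 2 by rewrite /Q; ring.
exact: sqr_ge0.
Qed.

(** * Polynomial majorants and minorants of a step *)

Section StepMajorants.
Variables (R : realFieldType) (t : R).

Let lfac (zs : seq R) : {poly R} := \prod_(z <- zs) ('X - z%:P).
Let rfac (bs : seq R) : {poly R} := \prod_(b <- bs) (b%:P - 'X).

(* [U] and [V] are the Hermite interpolants of the step at [t] with nodes [zs] to
   its left and [bs] to its right, the node [t] counted on the left for [U] and on
   the right for [V]; [C], [E], [C'], [E'] carry their signs. *)
Lemma step_interpolants (zs bs : seq R) :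
    {in zs, forall z, z < t} -> {in bs, forall b, t < b} ->
  exists (U V : {poly R}) (C E C' E' : R -> R),
    [/\ U - V = ((lfac zs).[t] * (rfac bs).[t])^-1 *: (lfac zs * rfac bs),
        forall x, [/\ U.[x] = (rfac bs).[x] * C x,
          1 - U.[x] = (lfac zs).[x] * (x - t) * E x,
          V.[x] = (rfac bs).[x] * (t - x) * C' x &
          1 - V.[x] = (lfac zs).[x] * E' x],
        forall x, t <= x -> 0 <= C x /\ 0 <= C' x &
        forall x, x <= t -> 0 <= E x /\ 0 <= E' x].
Proof.
(* The double induction stops when either list is empty; then [V = 0] or [U = 1]. *)
elim: zs bs => [|z zs IHz] bs.
  move=> _ bt; rewrite /lfac big_nil hornerC mul1r mul1r.
  have B0 x : x <= t -> 0 < (rfac bs).[t] <= (rfac bs).[x].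
    move=> xt; rewrite /rfac !horner_prod.
    elim: bs bt => [|b bs IH] bt; first by rewrite !big_nil ltr01 lexx.
    have /andP[h1 h2] : 0 < \prod_(b <- bs) (b%:P - 'X).[t]
        <= \prod_(b <- bs) (b%:P - 'X).[x].
      by apply: IH => c cb; apply: bt; rewrite inE cb orbT.
    have tb : t < b by apply: bt; rewrite inE eqxx.
    rewrite !big_cons !hornerE mulr_gt0 ?subr_gt0 //=.
    by apply: ler_pM; rewrite ?subr_ge0 ?(ltW tb) ?(ltW h1) // lerD2l lerN2.
  have /andP[Bt _] := B0 t (lexx t).
  (* At [x = t] the quotient for [E] is [0] by the convention on division; the identity for [1 - U]
     holds there since both sides vanish. *)
  exists ((rfac bs).[t]^-1 *: rfac bs), 0, (fun=> (rfac bs).[t]^-1),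
    (fun x => (1 - (rfac bs).[x] / (rfac bs).[t]) / (x - t)),
    (fun=> 0), (fun=> 1).
  split; first by rewrite subr0.
  - move=> x; rewrite !hornerE /=; split; rewrite ?mulr0 ?subr0 //; first by rewrite mulrC.
    have [->|xt] := eqVneq x t; first by rewrite mulVf ?gt_eqF // !(subrr, mul0r, mulr0).
    by field; rewrite subr_eq0 xt gt_eqF.
  - by move=> x _; rewrite lexx invr_ge0 ltW.
  - move=> x xt; split=> //; have /andP[_ h] := B0 x xt.
    by rewrite mulr_le0 ?invr_le0 ?subr_le0 // ler_pdivlMr // mul1r.
elim: bs => [|b bs IHb].
  move=> zt _; rewrite /rfac big_nil hornerC !mulr1.
  have A0 x : t <= x -> 0 < (lfac (z :: zs)).[t] <= (lfac (z :: zs)).[x].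
    move=> tx; rewrite /lfac !horner_prod.
    elim: (z :: zs) zt => [|c s IH] st; first by rewrite !big_nil ltr01 lexx.
    have /andP[h1 h2] : 0 < \prod_(b <- s) ('X - b%:P).[t]
        <= \prod_(b <- s) ('X - b%:P).[x].
      by apply: IH => y ys; apply: st; rewrite inE ys orbT.
    have ct : c < t by apply: st; rewrite inE eqxx.
    rewrite !big_cons !hornerE mulr_gt0 ?subr_gt0 //=.
    by apply: ler_pM; rewrite ?subr_ge0 ?(ltW ct) ?(ltW h1) // lerD2r.
  have /andP[At _] := A0 t (lexx t).
  set A := lfac (z :: zs) in A0 At *.
  exists 1, (1 - A.[t]^-1 *: A), (fun=> 1), (fun=> 0),
    (fun x => (1 - A.[x] / A.[t]) / (t - x)), (fun=> A.[t]^-1).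
  split; first by rewrite opprB addrC subrK.
  - move=> x; rewrite !hornerE /=; split; rewrite ?mulr0 ?subrr //; last by ring.
    have [->|xt] := eqVneq x t; first by rewrite mulVf ?gt_eqF // !(subrr, mul0r, mulr0).
    by field; rewrite subr_eq0 eq_sym xt gt_eqF.
  - move=> x tx; split=> //; have /andP[_ h] := A0 x tx.
    by rewrite mulr_le0 ?invr_le0 ?subr_le0 // ler_pdivlMr // mul1r.
  - by move=> x _; rewrite lexx invr_ge0 ltW.
move=> zt bt.
have zt' : {in zs, forall z, z < t} by move=> y ys; apply: zt; rewrite inE ys orbT.
have bt' : {in bs, forall b, t < b} by move=> y ys; apply: bt; rewrite inE ys orbT.
have z0 : z < t by apply: zt; rewrite inE eqxx.
have b0 : t < b by apply: bt; rewrite inE eqxx.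
have [U1 [V1 [C1 [E1 [C1' [E1' [D1 H1 HC1 HE1]]]]]]] := IHb zt bt'.
have [U2 [V2 [C2 [E2 [C2' [E2' [D2 H2 HC2 HE2]]]]]]] := IHz (b :: bs) zt' bt.
have lE : lfac (z :: zs) = ('X - z%:P) * lfac zs by rewrite /lfac big_cons.
have rE : rfac (b :: bs) = (b%:P - 'X) * rfac bs by rewrite /rfac big_cons.
have k0 : 0 < (b - z)^-1 by rewrite invr_gt0; lra.
pose k := (b - z)^-1.
(* Neville's recursion: the interpolant at all nodes combines those without [b] and without [z]. The
   weights [x - z] and [b - x] are nonnegative where the signs of [C] and [E] are claimed. *)
exists (k *: ((b%:P - 'X) * U1 + ('X - z%:P) * U2)),
  (k *: ((b%:P - 'X) * V1 + ('X - z%:P) * V2)),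
  (fun x => k * (C1 x + (x - z) * C2 x)), (fun x => k * ((b - x) * E1 x + E2 x)),
  (fun x => k * (C1' x + (x - z) * C2' x)),
  (fun x => k * ((b - x) * E1' x + E2' x)).
split.
- have lt0 : (lfac zs).[t] != 0.
    rewrite /lfac horner_prod prodf_seq_neq0; apply/allP => y /zt' yt /=.
    by rewrite !hornerE subr_eq0 gt_eqF.
  have rt0 : (rfac bs).[t] != 0.
    rewrite /rfac horner_prod prodf_seq_neq0; apply/allP => y /bt' yt /=.
    by rewrite !hornerE subr_eq0 gt_eqF.
  rewrite -scalerBr opprD addrACA -!mulrBr D1 D2 lE rE !hornerE /=.
  set c1 := (_ * (rfac bs).[t])^-1; set c2 := (_ * (rfac bs).[t])^-1.
  (* The constants agree because [(b - t) + (t - z) = b - z]. *)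
  transitivity ((k * (c1 + c2)) *: (('X - z%:P) * lfac zs * ((b%:P - 'X) * rfac bs))).
    by rewrite -!mul_polyC polyCM polyCD; ring.
  rewrite mulrA; congr (_ *: _); rewrite /k /c1 /c2; field.
  by rewrite lt0 rt0 /= !subr_eq0 !gt_eqF //; lra.
- move=> x; have := H1 x; have := H2 x; rewrite lE rE !hornerE /= /k.
  have bz : b - z != 0 by rewrite -invr_eq0 gt_eqF.
  move=> [h1 h2 h3 h4] [g1 g2 g3 g4]; split.
  + by rewrite h1 g1; ring.
  + have -> : U1.[x] = 1 - (1 - U1.[x]) by ring.
    have -> : U2.[x] = 1 - (1 - U2.[x]) by ring.
    by rewrite h2 g2; field.
  + by rewrite h3 g3; ring.
  + have -> : V1.[x] = 1 - (1 - V1.[x]) by ring.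
    have -> : V2.[x] = 1 - (1 - V2.[x]) by ring.
    by rewrite h4 g4; field.
- move=> x tx; have [a1 a2] := HC1 x tx; have [a3 a4] := HC2 x tx.
  have xz : 0 <= x - z by lra.
  by split; apply: mulr_ge0; rewrite ?(ltW k0) // addr_ge0 ?mulr_ge0.
- move=> x tx; have [a1 a2] := HE1 x tx; have [a3 a4] := HE2 x tx.
  have xz : 0 <= b - x by lra.
  by split; apply: mulr_ge0; rewrite ?(ltW k0) // addr_ge0 ?mulr_ge0.
Qed.

End StepMajorants.

(* The sharp form of the Chebyshev-Markov-Stieltjes inequalities: the step at [t] is
   squeezed between polynomials whose difference is at most [p ^ 2 / p(t) ^ 2]. *)
Lemma step_majorants (R : rcfType) (p : {poly R}) (t : R) : p.[t] != 0 ->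
  exists U V : {poly R},
    [/\ forall x, 0 <= U.[x], forall x, x <= t -> 1 <= U.[x],
        forall x, V.[x] <= 1, forall x, t <= x -> V.[x] <= 0 &
        forall x, p.[t] ^+ 2 * (U.[x] - V.[x]) <= p.[x] ^+ 2].
Proof.
move=> pt; have [rs trs Hrs] := real_rooted_minorant pt.
(* Every root is used as a double node: the products over nodes become squares, and only factors of
   known sign remain. *)
pose zs := [seq r <- rs | r < t]; pose bs := [seq r <- rs | ~~ (r < t)].
have zt : {in zs ++ zs, forall z, z < t}.
  by move=> z; rewrite mem_cat orbb mem_filter => /andP[].
have bt : {in bs ++ bs, forall b, t < b}.
  move=> b; rewrite mem_cat orbb mem_filter -leNgt le_eqVlt => /andP[+ brs].
  by case/orP => // /eqP bE; rewrite bE brs in trs.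
have [U [V [C [E [C' [E' [D H HC HE]]]]]]] := step_interpolants zt bt.
have sql x : (\prod_(z <- zs ++ zs) ('X - z%:P)).[x] = (\prod_(z <- zs) (x - z)) ^+ 2.
  rewrite big_cat hornerM -expr2 horner_prod; congr (_ ^+ 2).
  by apply: eq_bigr => z _; rewrite !hornerE.
have sqr x : (\prod_(b <- bs ++ bs) (b%:P - 'X)).[x] = (\prod_(b <- bs) (x - b)) ^+ 2.
  rewrite big_cat hornerM -expr2 horner_prod -[RHS]sqrrN.
  suff -> : \prod_(b <- bs) (x - b) =
      (-1) ^+ size bs * \prod_(b <- bs) (b%:P - 'X).[x].
    by rewrite sqrrN exprMn -exprM mulnC exprM sqrrN expr1n expr1n mul1r.
  elim: (bs) => [|b s IH]; first by rewrite !big_nil mulr1.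
  by rewrite !big_cons IH /= exprS !hornerE /=; ring.
have U1 x : x <= t -> 1 <= U.[x].
  move=> xt; have [_ h _ _] := H x; have [e _] := HE x xt.
  rewrite -subr_le0 h sql mulr_le0_ge0 // mulr_ge0_le0 ?sqr_ge0 //; lra.
have V0 x : t <= x -> V.[x] <= 0.
  move=> xt; have [_ _ h _] := H x; have [_ c] := HC x xt.
  rewrite h sqr mulr_le0_ge0 // mulr_ge0_le0 ?sqr_ge0 //; lra.
exists U, V; split=> // x.
- case: (leP x t) => [/U1|/ltW xt]; first by apply: le_trans.
  have [h _ _ _] := H x; have [c _] := HC x xt.
  by rewrite h sqr mulr_ge0 ?sqr_ge0.
- case: (leP t x) => [/V0|/ltW xt]; first by move/le_trans; apply.
  have [_ _ _ h] := H x; have [_ e] := HE x xt.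
  by rewrite -subr_ge0 h sql mulr_ge0 ?sqr_ge0.
rewrite -hornerN -hornerD D hornerZ hornerM !sql !sqr.
have -> : p.[t] ^+ 2 * (((\prod_(z <- zs) (t - z)) ^+ 2 * (\prod_(b <- bs) (t - b)) ^+ 2)^-1
    * ((\prod_(z <- zs) (x - z)) ^+ 2 * (\prod_(b <- bs) (x - b)) ^+ 2)) =
    (`|p.[t]| * `|\prod_(r <- rs) ((x - r) / (t - r))|) ^+ 2.
  rewrite exprMn !real_normK ?num_real //; congr (_ * _).
  have zbE (y : R) : (\prod_(z <- zs) (y - z)) ^+ 2 * (\prod_(b <- bs) (y - b)) ^+ 2 =
      (\prod_(r <- rs) (y - r)) ^+ 2.
    by rewrite -exprMn !big_filter [in RHS](bigID (fun r => r < t)).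
  by rewrite !zbE prodf_div exprMn exprVn mulrC.
by rewrite -[leRHS]real_normK ?num_real // lerXn2r ?nnegrE ?mulr_ge0.
Qed.

(** * The moment functional on polynomials *)

Section MomentFunctional.
Variables (R : rcfType) (s : nat -> R).

Definition mom (p : {poly R}) : R := \sum_(i < size p) p`_i * s i.

Lemma mom_widen n (p : {poly R}) : (size p <= n)%N -> mom p = \sum_(i < n) p`_i * s i.
Proof.
move=> pn; rewrite /mom (big_ord_widen n (fun i => p`_i * s i) pn) big_mkcond /=.
by apply: eq_bigr => i _; case: ltnP => // ?; rewrite nth_default ?mul0r.
Qed.

Lemma momD p q : mom (p + q) = mom p + mom q.
Proof.
rewrite (mom_widen (size_polyD p q)) (mom_widen (leq_maxl _ _ : _ <= maxn _ (size q))%N).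
rewrite (mom_widen (leq_maxr (size p) _)) -big_split /=.
by apply: eq_bigr => i _; rewrite coefD mulrDl.
Qed.

Lemma momZ a p : mom (a *: p) = a * mom p.
Proof.
rewrite (mom_widen (size_scale_leq a p)) /mom mulr_sumr.
by apply: eq_bigr => i _; rewrite coefZ mulrA.
Qed.

Lemma momB p q : mom (p - q) = mom p - mom q.
Proof. by rewrite momD -scaleN1r momZ mulN1r. Qed.

Lemma momXn k : mom 'X^k = s k.
Proof.
rewrite /mom size_polyXn big_ord_recr big1 /= ?add0r ?coefXn ?eqxx ?mul1r // => i _.
by rewrite coefXn ltn_eqF ?mul0r.
Qed.

Lemma mom_sum (I : Type) (r : seq I) (F : I -> {poly R}) :
  mom (\sum_(i <- r) F i) = \sum_(i <- r) mom (F i).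
Proof.
apply: (big_morph mom momD); by rewrite /mom size_poly0 big_ord0.
Qed.

Lemma mom_sqr p : mom (p ^+ 2) =
  \sum_(i < size p) \sum_(j < size p) p`_i * p`_j * s (i + j)%N.
Proof.
rewrite expr2 {1 2}[p](_ : _ = \sum_(i < size p) p`_i *: 'X^i); last first.
  by rewrite -[LHS]coefK poly_def.
rewrite mulr_suml mom_sum; apply: eq_bigr => i _.
rewrite mulr_sumr mom_sum; apply: eq_bigr => j _.
by rewrite -scalerAl -scalerAr -exprD scalerA momZ momXn.
Qed.

Hypothesis s_pos : forall p, 0 <= mom (p ^+ 2).

Lemma mom_ge0 p : (forall x, 0 <= p.[x]) -> 0 <= mom p.
Proof.
by move/nonneg_poly_sum_squares => [f [g ->]]; rewrite momD addr_ge0.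
Qed.

Lemma mom_le p q : (forall x, p.[x] <= q.[x]) -> mom p <= mom q.
Proof.
move=> pq; rewrite -subr_ge0 -momB mom_ge0 // => x.
by rewrite hornerD hornerN subr_ge0.
Qed.

End MomentFunctional.

End RealPolynomials.

(** * The Hahn-Banach theorem *)

Module HahnBanachTheorem.

Import all_boot all_order all_algebra boolp classical_sets reals ring lra.
Import Order.TTheory GRing.Theory Num.Theory.
Set Implicit Arguments. Unset Strict Implicit. Unset Printing Implicit Defensive.
Local Open Scope ring_scope.
Local Open Scope classical_set_scope.

Section HahnBanach.
Variables (R : realType) (V : lmodType R) (E : set V).
Hypothesis ED : forall x y, E x -> E y -> E (x + y).
Hypothesis EZ : forall a x, E x -> E (a *: x).

(** Relative to [E], which will be the functions of polynomial growth among all real functions. *)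
Definition sublinear_on (q : V -> R) :=
  (forall x y, E x -> E y -> q (x + y) <= q x + q y) /\
  (forall a x, 0 <= a -> E x -> q (a *: x) = a * q x).

Let EN x : E x -> E (- x).
Proof. by rewrite -scaleN1r; exact: EZ. Qed.

Let sublinear_on0 q x : E x -> sublinear_on q -> q 0 = 0.
Proof. by move=> Ex [_ /(_ 0 x (lexx _) Ex)]; rewrite scale0r mul0r. Qed.

Let sublinear_onN q x : E x -> sublinear_on q -> - q (- x) <= q x.
Proof.
move=> Ex qs; have := qs.1 _ _ Ex (EN Ex).
rewrite subrr (sublinear_on0 Ex qs); lra.
Qed.

(** The inequality for [a^-1] and [a *: x] is the converse of the one for [a] and [x]. *)
Let homogeneous_of_ge (f : V -> R) :
  (forall x, E x -> f 0 = 0) ->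
  (forall a x, 0 < a -> E x -> a * f x <= f (a *: x)) ->
  forall a x, 0 <= a -> E x -> f (a *: x) = a * f x.
Proof.
move=> f0 fZ a x; rewrite le_eqVlt => /predU1P[<-|a0] Ex.
  by rewrite scale0r mul0r (f0 x).
apply: le_anti; rewrite fZ // andbT mulrC -ler_pdivrMr // mulrC.
have := fZ a^-1 (a *: x); rewrite scalerA mulVf ?gt_eqF // scale1r.
by apply; [rewrite invr_gt0|exact: EZ].
Qed.

(** Zorn's lemma. The infimum of a chain is finite, as each member satisfies [q x >= - p (- x)], and
    subadditive, as of two members of a chain one lies below the other. *)
Let minimal_sublinear (p : V -> R) : sublinear_on p ->
  exists q, [/\ sublinear_on q, forall x, E x -> q x <= p x &
    forall r, sublinear_on r -> (forall x, E x -> r x <= q x) ->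
      forall x, E x -> q x <= r x].
Proof.
move=> ps.
pose T := {q : V -> R | sublinear_on q /\ forall x, E x -> q x <= p x}.
pose p' : T := exist _ p (conj ps (fun x _ => lexx (p x))).
(* The order is reversed: maximal for [le] means minimal as a functional. *)
pose le (q1 q2 : T) := `[< forall x, E x -> sval q2 x <= sval q1 x >].
have [||A Atot|[q [qs qp]] qmin] := @ZL_preorder T p' le.
- by move=> q; apply/asboolP.
- move=> q1 q2 q3 /asboolP h1 /asboolP h2; apply/asboolP => x Ex.
  exact: le_trans (h2 x Ex) (h1 x Ex).
- have [[q0 Aq0]|A0] := pselect (exists q, A q); last first.
    by exists p' => q Aq; exfalso; apply: A0; exists q.
  pose S x := [set sval q x | q in A].
  have Sn x : S x !=set0 by exists (sval q0 x), q0.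
  have Slb x : E x -> has_lbound (S x).
    move=> Ex; exists (- p (- x)) => _ [q Aq <-].
    case: q {Aq} => q [qs qp] /=; apply: le_trans (sublinear_onN Ex qs).
    by rewrite lerN2 qp //; exact: EN.
  have fs : sublinear_on (fun x => inf (S x)).
    split=> [x y Ex Ey|].
      rewrite -lerBlDr; apply: lb_le_inf => // _ [q1 Aq1 <-].
      rewrite lerBlDr -lerBlDl; apply: lb_le_inf => // _ [q2 Aq2 <-].
      rewrite lerBlDl.
      have [q Aq [h1 h2]] : exists2 q, A q & (forall z, E z -> sval q z <= sval q1 z) /\
          (forall z, E z -> sval q z <= sval q2 z).
        by have [/asboolP h|/asboolP h] := Atot _ _ Aq1 Aq2; [exists q2|exists q1].
      apply: (@le_trans _ _ (sval q (x + y))).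
        by apply: ge_inf; [exact/Slb/ED|exists q].
      apply: le_trans ((svalP q).1.1 x y Ex Ey) _.
      by rewrite lerD ?h1 ?h2.
    apply: homogeneous_of_ge => [x Ex|a x a0 Ex].
      rewrite (_ : S 0 = [set 0]) ?inf1 //; apply/seteqP; split=> [_ [q Aq <-]|_ ->] /=.
        exact: sublinear_on0 Ex (svalP q).1.
      by exists q0 => //; exact: sublinear_on0 Ex (svalP q0).1.
    apply: lb_le_inf => // _ [q Aq <-].
    rewrite ((svalP q).1.2 _ _ (ltW a0) Ex) ler_pM2l //.
    by apply: ge_inf; [exact: Slb|exists q].
  have fp x : E x -> inf (S x) <= p x.
    move=> Ex; apply: le_trans ((svalP q0).2 x Ex).
    by apply: ge_inf; [exact: Slb|exists q0].
  exists (exist _ (fun x => inf (S x)) (conj fs fp)) => q Aq.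
  by apply/asboolP => x Ex /=; apply: ge_inf; [exact: Slb|exists q].
exists q; split=> // r rs rq.
have rp x : E x -> r x <= p x by move=> Ex; apply: le_trans (rq x Ex) (qp x Ex).
have := qmin (exist _ r (conj rs rp)); rewrite /le /= => h.
by have /asboolP := h (introT (asboolP _) rq).
Qed.

(* A minimal sublinear functional is odd, hence linear. *)
Theorem hahn_banach (p : V -> R) : sublinear_on p ->
  exists q : V -> R, [/\ forall x y, E x -> E y -> q (x + y) = q x + q y,
    forall a x, E x -> q (a *: x) = a * q x & forall x, E x -> q x <= p x].
Proof.
move=> /minimal_sublinear[q [qs qp qmin]]; exists q.
have qN y : E y -> q (- y) = - q y.
  move=> Ey; apply: le_anti; rewrite -[- q y <= _]lerNl sublinear_onN // andbT.
  (* The infimum of [S x] is sublinear in [x] and at most [q x] (take [t = 0]), so by minimality [q]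
     lies below it; [t = 1] at [x = - y] then gives [q (- y) <= - q y]. *)
  pose S x := [set q (x + t *: y) - t * q y | t in [set t | 0 <= t]].
  have S0 x : S x (q x) by exists 0 => //=; rewrite scale0r addr0 mul0r subr0.
  have Sn x : S x !=set0 by exists (q x).
  have Slb x : E x -> has_lbound (S x).
    move=> Ex; exists (- q (- x)) => _ [t t0 <-].
    have := qs.1 (x + t *: y) (- x) (ED Ex (EZ t Ey)) (EN Ex).
    by rewrite addrAC subrr add0r qs.2 //; lra.
  have rs : sublinear_on (fun x => inf (S x)).
    split=> [x z Ex Ez|].
      rewrite -lerBlDr; apply: lb_le_inf => // _ [t1 /= t10 <-].
      rewrite lerBlDr -lerBlDl; apply: lb_le_inf => // _ [t2 /= t20 <-].
      rewrite lerBlDl.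
      apply: (@le_trans _ _ (q (x + z + (t1 + t2) *: y) - (t1 + t2) * q y)).
        by apply: ge_inf; [exact/Slb/ED|exists (t1 + t2) => //=; rewrite addr_ge0].
      have := qs.1 (x + t1 *: y) (z + t2 *: y) (ED Ex (EZ t1 Ey)) (ED Ez (EZ t2 Ey)).
      rewrite addrACA -scalerDl; lra.
    apply: homogeneous_of_ge => [x Ex|a x a0 Ex].
      rewrite (_ : S 0 = [set 0]) ?inf1 //; apply/seteqP; split=> [_ [t /= t0 <-]|_ ->].
        by rewrite /= add0r qs.2 // subrr.
      by have := S0 0; rewrite (sublinear_on0 Ex qs).
    apply: lb_le_inf => // _ [t /= t0 <-].
    have -> : q (a *: x + t *: y) - t * q y = a * (q (x + (t / a) *: y) - (t / a) * q y).
      rewrite mulrBr -(qs.2 a _ (ltW a0) (ED Ex (EZ (t / a) Ey))).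
      by rewrite scalerDr scalerA !mulrA [a * t]mulrC mulfK ?gt_eqF.
    rewrite ler_pM2l //; apply: ge_inf; first exact: Slb.
    by exists (t / a) => //=; rewrite divr_ge0 // ltW.
  apply: le_trans (qmin _ rs _ _ (EN Ey)) _.
    by move=> x Ex; apply: ge_inf; [exact: Slb|exact: S0].
  apply: ge_inf; first exact/Slb/EN.
  by exists 1 => //=; rewrite scale1r addNr (sublinear_on0 Ey qs) mul1r add0r.
split=> // [x y Ex Ey|a x Ex].
  (* For the converse, [x = (x + y) + (- y)] and oddness. *)
  apply: le_anti; rewrite qs.1 //=.
  have := qs.1 (x + y) (- y) (ED Ex Ey) (EN Ey); rewrite addrK qN //; lra.
case: (leP 0 a) => a0; first by rewrite qs.2.
by rewrite -[a in LHS]opprK scaleNr qN ?qs.2 ?oppr_ge0 ?ltW //; [ring|exact: EZ].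
Qed.

End HahnBanach.

End HahnBanachTheorem.

(** * Positive sequences and the moment functional *)

Module MomentSequences.

Import all_boot all_order all_algebra boolp classical_sets functions reals Rstruct.
Import Order.TTheory GRing.Theory Num.Theory RealPolynomials HahnBanachTheorem.
Set Implicit Arguments. Unset Strict Implicit. Unset Printing Implicit Defensive.
Local Notation R := Rdefinitions.R.
Local Open Scope ring_scope.
Local Open Scope classical_set_scope.

Lemma rsumE (g : nat -> R) n : rsum g n = \sum_(i < n) g i.
Proof. by elim: n => [|n IH] /=; rewrite ?big_ord0 // big_ord_recr /= IH. Qed.

Lemma positive_seq_mom (s : nat -> R) :
  positive_seq s <-> forall p : {poly R}, 0 <= mom s (p ^+ 2).
Proof.
split=> [sp p|sp n c].
  rewrite mom_sqr; case: (size p) => [|n]; first by rewrite big_ord0.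
  move/RleP: (sp n (fun i => p`_i)); rewrite rsumE.
  by under eq_bigr do rewrite rsumE.
have := sp (\poly_(i < n.+1) c i).
set p := \poly_(i < _) _.
have pn : (size p <= n.+1)%N := size_poly _ _.
rewrite mom_sqr => /RleP; congr Rle; rewrite rsumE.
transitivity (\sum_(i < n.+1) \sum_(j < size p) p`_i * p`_j * s (i + j)%N).
  rewrite (big_ord_widen _ (fun i => \sum_(j < size p) p`_i * p`_j * s (i + j)%N) pn).
  rewrite big_mkcond; apply: eq_bigr => i _; case: ltnP => // h.
  by rewrite big1 // => j _; rewrite nth_default // !mul0r.
apply: eq_bigr => i _; rewrite rsumE.
rewrite (big_ord_widen _ (fun j => p`_i * p`_j * s (i + j)%N) pn).
rewrite big_mkcond; apply: eq_bigr => j _.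
have cE (k : 'I_n.+1) : p`_k = c k by rewrite coef_poly ltn_ord.
rewrite -!cE !RmultE; case: ltnP => // h.
by rewrite (nth_default 0 h) mulr0 mul0r.
Qed.

Definition poly_growth (f : R -> R) := exists P : {poly R}, forall x, `|f x| <= P.[x].

Lemma poly_growthD f g : poly_growth f -> poly_growth g ->
  poly_growth (fun x => Rplus (f x) (g x)).
Proof.
move=> [P fP] [Q gQ]; exists (P + Q) => x; rewrite hornerD.
by apply: le_trans (ler_normD _ _) _; rewrite lerD.
Qed.

Lemma poly_growthZ a f : poly_growth f -> poly_growth (fun x => Rmult a (f x)).
Proof.
move=> [P fP]; exists (`|a| *: P) => x; rewrite hornerZ.
by rewrite [leLHS]normrM ler_wpM2l.
Qed.

Lemma poly_growth_dom (A : R) k f :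
  (forall x, Rle (Rabs (f x)) (Rmult A (Rplus 1 (pow x k)))) -> poly_growth f.
Proof.
move=> H; exists (A *: (1 + 'X^k)) => x; rewrite !hornerE -RpowE -RabsE.
exact/RleP.
Qed.

Lemma poly_growth_pow k : poly_growth (fun x => pow x k).
Proof.
apply: (@poly_growth_dom 1 (k * 2)) => x.
have -> : pow x (k * 2) = pow (pow x k) 2 by rewrite -pow_mult.
by unfold Rabs; destruct (Rcase_abs (pow x k)); nra.
Qed.

(** Hahn-Banach with [p f] the infimum of the moments of the polynomials above [f]. Domination by
    [p] gives positivity, since [p f <= 0] for [f <= 0], and also the moments, from the bounds for
    [x ^ k] and [- x ^ k]. *)
Lemma moment_functional (s : nat -> R) : positive_seq s ->
  exists Lam : (R -> R) -> R,
    [/\ forall f g, poly_growth f -> poly_growth g ->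
          Lam (fun x => Rplus (f x) (g x)) = Rplus (Lam f) (Lam g),
        forall a f, poly_growth f -> Lam (fun x => Rmult a (f x)) = Rmult a (Lam f),
        forall f, poly_growth f -> (forall x, Rle 0 (f x)) -> Rle 0 (Lam f) &
        forall k, Lam (fun x => pow x k) = s k].
Proof.
move=> /positive_seq_mom sp.
pose V : lmodType R := (R -> R^o).
have ED (f g : V) : poly_growth f -> poly_growth g -> poly_growth (f + g).
  exact: poly_growthD.
have EZ (a : R) (f : V) : poly_growth f -> poly_growth (a *: f).
  exact: poly_growthZ.
pose S (f : V) := [set mom s P | P in [set P : {poly R} | forall x, f x <= P.[x]]].
have Slb (f : V) : poly_growth f -> has_lbound (S f).
  move=> [Q fQ]; exists (mom s (- Q)) => _ [P fP <-]; apply: mom_le => // x.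
  rewrite hornerN; apply: le_trans (fP x); rewrite lerNl.
  by apply: le_trans (fQ x); rewrite -normrN ler_norm.
have Sn (f : V) : poly_growth f -> S f !=set0.
  move=> [Q fQ]; exists (mom s Q), Q => //= x.
  by apply: le_trans (fQ x); rewrite ler_norm.
pose p (f : V) := inf (S f).
have pub (f : V) (P : {poly R}) : poly_growth f -> (forall x, f x <= P.[x]) ->
    p f <= mom s P.
  by move=> Ef fP; apply: ge_inf; [exact: Slb|exists P].
have ps : @sublinear_on _ V poly_growth p.
  split=> [f g Ef Eg|a f].
    rewrite -lerBlDr; apply: lb_le_inf; first exact: Sn.
    move=> _ [P fP <-]; rewrite lerBlDr -lerBlDl.
    apply: lb_le_inf; first exact: Sn.
    move=> _ [Q gQ <-]; rewrite lerBlDl -momD; apply: pub; first exact: ED.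
    by move=> x; rewrite hornerD lerD.
  rewrite le_eqVlt => /predU1P[<-|a0] Ef.
    rewrite scale0r mul0r.
    have E0 : poly_growth (0 : V) by exists 0 => x; rewrite normr0 hornerC.
    have m0 : mom s 0 = 0 by rewrite -(scale0r 0) momZ mul0r.
    apply: le_anti; apply/andP; split.
      by rewrite -[leRHS]m0; apply: pub => // x; rewrite hornerC.
    apply: lb_le_inf; first exact: Sn.
    by move=> _ [P fP <-]; rewrite -m0; apply: mom_le => // x; rewrite hornerC; apply: fP.
  have h (b : R) (g : V) : 0 < b -> poly_growth g -> b * p g <= p (b *: g).
    move=> b0 Eg; apply: lb_le_inf; first exact/Sn/EZ.
    move=> _ [P gP <-]; rewrite -ler_pdivlMl // -momZ; apply: pub => // x.
    by rewrite hornerZ ler_pdivlMl //; exact: gP.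
  apply: le_anti; rewrite h // andbT -ler_pdivrMl //.
  have := h a^-1 (a *: f); rewrite scalerA mulVf ?gt_eqF // scale1r.
  by apply; [rewrite invr_gt0|exact: EZ].
have [L [LD LZ Lp]] := @hahn_banach _ V poly_growth ED EZ p ps.
have Lnp (f : V) : poly_growth f -> (forall x, f x <= 0) -> L f <= 0.
  move=> Ef f0; apply: le_trans (Lp f Ef) _.
  have -> : 0 = mom s 0 by rewrite -(scale0r 0) momZ mul0r.
  by apply: pub => // x; rewrite hornerC.
exists L; split.
- exact: LD.
- exact: LZ.
- move=> f Ef f0; apply/RleP; rewrite -oppr_le0 -mulN1r -(LZ (-1) f Ef).
  apply: Lnp => [|x]; first exact: EZ.
  by change ((-1 : R) * f x <= 0); rewrite mulN1r oppr_le0; exact/RleP.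
- move=> k.
  have Eg : poly_growth (fun x => pow x k) by exact: poly_growth_pow.
  apply: le_anti; apply/andP; split.
    apply: le_trans (Lp _ Eg) _; rewrite -(momXn s k); apply: pub => // x.
    by rewrite hornerXn RpowE.
  have -> : s k = - mom s (-1 *: 'X^k) by rewrite momZ momXn mulN1r opprK.
  rewrite -[leRHS]opprK lerN2 -[leLHS]mulN1r -(LZ (-1) _ Eg).
  apply: le_trans (Lp _ (EZ _ _ Eg)) _; apply: pub => [|x]; first exact: EZ.
  by rewrite hornerZ hornerXn -RpowE.
Qed.

(** The largest such [c] is the infimum of [mom s (p ^ 2)] over [p(t) = 1], the limit of the
    Christoffel functions at [t]. *)
Definition evaluation_bounded (s : nat -> R) (c t : R) :=
  forall p : {poly R}, c * p.[t] ^+ 2 <= mom s (p ^+ 2).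

(** The moment functional on polynomial functions, in the form in which they are integrated
    below. *)
Definition poly_moment (s : nat -> R) (f : R -> R) (I : R) :=
  exists n (c : nat -> R), (forall x, f x = rsum (fun i => Rmult (c i) (pow x i)) n) /\
    I = rsum (fun i => Rmult (c i) (s i)) n.

Lemma poly_moment_horner s (p : {poly R}) : poly_moment s (horner p) (mom s p).
Proof.
exists (size p), (fun i => p`_i); split=> [x|]; rewrite rsumE //.
by rewrite horner_coef; apply: eq_bigr => i _; rewrite RpowE.
Qed.

(** For [p] violating the bound, positivity forces [p(t) != 0], and the majorants built from [p]
    satisfy [p(t)^2 (u - v) <= mom s (p ^ 2) < c p(t)^2]. *)
Lemma evaluation_unbounded_step s (c t : R) : positive_seq s ->
  ~ evaluation_bounded s c t ->
  exists (U V : R -> R) (u v : R),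
    [/\ poly_moment s U u, poly_moment s V v & Rlt (Rminus u v) c] /\
    [/\ forall x, Rle 0 (U x), forall x, Rle x t -> Rle 1 (U x),
      forall x, Rle (V x) 1 & forall x, Rle t x -> Rle (V x) 0].
Proof.
move=> /positive_seq_mom sp /existsNP[p /negP]; rewrite -ltNge => pc.
have pt : p.[t] != 0.
  apply/eqP => p0; move: pc; rewrite p0 expr0n mulr0 ltNge => /negP; apply; exact: sp.
have p2 : 0 < p.[t] ^+ 2 by rewrite lt_def sqr_ge0 expf_eq0 pt.
have [U [V [U0 U1 V1 V0 UV]]] := step_majorants pt.
exists (horner U), (horner V), (mom s U), (mom s V); split; split.
- exact: poly_moment_horner.
- exact: poly_moment_horner.
- apply/RltP; rewrite RminusE -momB -(ltr_pM2l p2) -momZ [ltRHS]mulrC.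
  apply: le_lt_trans pc; apply: mom_le => // x.
  by rewrite hornerZ hornerD hornerN horner_exp.
- by move=> x; apply/RleP.
- by move=> x /RleP xt; apply/RleP/U1.
- by move=> x; apply/RleP.
- by move=> x /RleP xt; apply/RleP/V0.
Qed.

Lemma mom_subseq (s : nat -> R) d m (p : {poly R}) :
  mom (fun k => s (k * d + m)%N) p = mom s ('X^m * (p \Po 'X^d)).
Proof.
rewrite comp_polyE mulr_sumr mom_sum [LHS]/mom; apply: eq_bigr => i _.
by rewrite -scalerAr momZ -exprM -exprD momXn addnC mulnC [(m + _)%N]addnC mulnC.
Qed.

(** The even shift lets squares go to squares, so positivity and evaluation bounds pass to the
    subsequence. *)
Lemma mom_subseq_sqr (s : nat -> R) d m (p : {poly R}) :
  mom (fun k => s (k * d + m * 2)%N) (p ^+ 2) =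
  mom s (('X^m * (p \Po 'X^d)) ^+ 2).
Proof. by rewrite mom_subseq rmorphXn /= exprMn -exprM. Qed.

Lemma positive_subseq s d l0 : positive_seq s -> Nat.Even l0 ->
  positive_seq (fun k => s (Nat.add (Nat.mul k d) l0)).
Proof.
move=> /positive_seq_mom sp [m ->]; apply/positive_seq_mom => p.
by have := mom_subseq_sqr s d m p; rewrite mulnC => ->.
Qed.

(** With [l0 = 2 m], the polynomial [X^m p(X^d)] has the value [t^m p(t^d)] at [t]. *)
Lemma evaluation_bounded_subseq s d l0 (c t : R) : Nat.Even l0 ->
  evaluation_bounded s c t ->
  evaluation_bounded (fun k => s (Nat.add (Nat.mul k d) l0)) (Rmult c (pow t l0)) (pow t d).
Proof.
move=> [m ->] sc p; have := mom_subseq_sqr s d m p; rewrite mulnC => ->.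
apply: le_trans (sc _); rewrite hornerM hornerXn horner_comp hornerXn !RpowE.
by rewrite RmultE exprMn -exprM -mulrA [(m * 2)%N]mulnC.
Qed.

Lemma evaluation_bounded_le s (c c' t : R) : Rle c' c ->
  evaluation_bounded s c t -> evaluation_bounded s c' t.
Proof.
by move=> /RleP cc sc p; apply: le_trans (sc p); rewrite ler_wpM2r ?sqr_ge0.
Qed.

(** The quadratic form of the new sequence is [mom s (p ^ 2) - c p(w)^2]. *)
Lemma positive_sub_atom s (c w : R) : evaluation_bounded s c w ->
  positive_seq (fun k => Rminus (s k) (Rmult c (pow w k))).
Proof.
move=> sc; apply/positive_seq_mom => p.
rewrite [mom _ _](_ : _ = mom s (p ^+ 2) - c * p.[w] ^+ 2) ?subr_ge0 //.
rewrite -horner_exp horner_coef /mom mulr_sumr -sumrB; apply: eq_bigr => i _.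
by rewrite RpowE RminusE RmultE mulrBr mulrCA.
Qed.

End MomentSequences.

Import MomentSequences.
Open Scope R_scope.

(** * Riemann-Stieltjes integrals *)

Lemma rsum_lin (a b : R) (f g : nat -> R) n :
  rsum (fun i => a * f i + b * g i) n = a * rsum f n + b * rsum g n.
Proof. induction n as [|n IH]; simpl; [ring|rewrite IH; ring]. Qed.

Lemma rsum_ext (f g : nat -> R) n : (forall i, f i = g i) -> rsum f n = rsum g n.
Proof. intros H. induction n as [|n IH]; simpl; [reflexivity|now rewrite IH, H]. Qed.

Lemma partition_bounds a b n p t i : tagged_partition a b n p t ->
  (i <= n)%nat -> a <= p i <= b.
Proof.
intros [Ha [Hb [H _]]] Hi.
assert (Hmono : forall j k, (j + k <= n)%nat -> p j <= p (j + k)%nat).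
{ intros j k. induction k as [|k IH]; intros Hk.
  - rewrite Nat.add_0_r. lra.
  - rewrite Nat.add_succ_r. specialize (IH ltac:(lia)).
    specialize (H (j + k)%nat ltac:(lia)). lra. }
rewrite <- Ha, <- Hb. split.
- exact (Hmono O i Hi).
- replace n with (i + (n - i))%nat by lia. apply Hmono. lia.
Qed.

(** The tag rule depends on the cell only, so it can be fixed before the partition is known. *)
Lemma fine_partition a b (tag : R -> R -> R) delta : a < b -> 0 < delta ->
  (forall x y, x < y -> x <= tag x y <= y) ->
  exists n p, tagged_partition a b n p (fun i => tag (p i) (p (S i))) /\
    mesh_lt n p delta.
Proof.
intros Hab Hd Htag.
destruct (INR_unbounded ((b - a) / delta)) as [n Hn].
assert (Hn0 : 0 < INR n).
{ apply Rlt_trans with (2 := Hn). apply Rdiv_lt_0_compat; lra. }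
pose (p := fun i => a + INR i * ((b - a) / INR n)).
assert (Hstep : forall i, p (S i) - p i = (b - a) / INR n).
{ intros i. unfold p. rewrite S_INR. ring. }
assert (H0 : 0 < (b - a) / INR n) by (apply Rdiv_lt_0_compat; lra).
exists n, p. split; [split; [|split; [|split]]|].
- unfold p. simpl. ring.
- unfold p. field. lra.
- intros i _. specialize (Hstep i). lra.
- intros i _. apply Htag. specialize (Hstep i). lra.
- intros i _. rewrite Hstep. apply (Rmult_lt_reg_r (INR n)); [exact Hn0|].
  apply (Rmult_lt_compat_r delta) in Hn; [|exact Hd].
  replace ((b - a) / INR n * INR n) with (b - a) by (field; lra).
  replace ((b - a) / delta * delta) with (b - a) in Hn by (field; lra). lra.
Qed.

Lemma RS_integral_lin (alpha beta : R) f g sigma a b I J :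
  RS_integral f sigma a b I -> RS_integral g sigma a b J ->
  RS_integral (fun x => alpha * f x + beta * g x) sigma a b (alpha * I + beta * J).
Proof.
intros Hf Hg eps Heps.
set (K := Rabs alpha + Rabs beta + 1).
assert (HK : 0 < K).
{ unfold K. pose proof (Rabs_pos alpha). pose proof (Rabs_pos beta). lra. }
assert (HeK : 0 < eps / K) by (apply Rdiv_lt_0_compat; lra).
destruct (Hf _ HeK) as [d1 [Hd1 H1]]. destruct (Hg _ HeK) as [d2 [Hd2 H2]].
exists (Rmin d1 d2). split; [now apply Rmin_glb_lt|].
intros n p t Hp Hm.
assert (Hm1 : mesh_lt n p d1).
{ intros i Hi. specialize (Hm i Hi). pose proof (Rmin_l d1 d2). lra. }
assert (Hm2 : mesh_lt n p d2).
{ intros i Hi. specialize (Hm i Hi). pose proof (Rmin_r d1 d2). lra. }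
specialize (H1 n p t Hp Hm1). specialize (H2 n p t Hp Hm2).
replace (RS_sum (fun x => alpha * f x + beta * g x) sigma n p t)
  with (alpha * RS_sum f sigma n p t + beta * RS_sum g sigma n p t).
2:{ unfold RS_sum. rewrite <- rsum_lin. apply rsum_ext. intros i. ring. }
replace (alpha * RS_sum f sigma n p t + beta * RS_sum g sigma n p t - (alpha * I + beta * J))
  with (alpha * (RS_sum f sigma n p t - I) + beta * (RS_sum g sigma n p t - J)) by ring.
apply Rle_lt_trans with (1 := Rabs_triang _ _). rewrite !Rabs_mult.
replace eps with (K * (eps / K)) by (field; lra). unfold K at 1.
pose proof (Rabs_pos alpha). pose proof (Rabs_pos beta). nra.
Qed.

Lemma RS_integral_R_lin (alpha beta : R) f g sigma I J :
  RS_integral_R f sigma I -> RS_integral_R g sigma J ->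
  RS_integral_R (fun x => alpha * f x + beta * g x) sigma (alpha * I + beta * J).
Proof.
intros Hf Hg eps Heps.
set (K := Rabs alpha + Rabs beta + 1).
assert (HK : 0 < K).
{ unfold K. pose proof (Rabs_pos alpha). pose proof (Rabs_pos beta). lra. }
assert (HeK : 0 < eps / K) by (apply Rdiv_lt_0_compat; lra).
destruct (Hf _ HeK) as [M1 H1]. destruct (Hg _ HeK) as [M2 H2].
exists (Rmax M1 M2). intros a b Ha Hb.
pose proof (Rmax_l M1 M2). pose proof (Rmax_r M1 M2).
destruct (H1 a b) as [I' [HI1 HI2]]; [lra|lra|].
destruct (H2 a b) as [J' [HJ1 HJ2]]; [lra|lra|].
exists (alpha * I' + beta * J'). split; [now apply RS_integral_lin|].
replace (alpha * I' + beta * J' - (alpha * I + beta * J))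
  with (alpha * (I' - I) + beta * (J' - J)) by ring.
apply Rle_lt_trans with (1 := Rabs_triang _ _). rewrite !Rabs_mult.
replace eps with (K * (eps / K)) by (field; lra). unfold K at 1.
pose proof (Rabs_pos alpha). pose proof (Rabs_pos beta). nra.
Qed.

Lemma RS_integral_ext f g sigma a b I : (forall x, f x = g x) ->
  RS_integral f sigma a b I -> RS_integral g sigma a b I.
Proof.
intros Hfg H eps Heps. destruct (H eps Heps) as [d [Hd Hd']].
exists d. split; [exact Hd|]. intros n p t Hp Hm.
replace (RS_sum g sigma n p t) with (RS_sum f sigma n p t); [now apply Hd'|].
apply rsum_ext. intros i. now rewrite Hfg.
Qed.

Lemma RS_integral_R_ext f g sigma I : (forall x, f x = g x) ->
  RS_integral_R f sigma I -> RS_integral_R g sigma I.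
Proof.
intros Hfg H eps Heps. destruct (H eps Heps) as [M HM]. exists M. intros a b Ha Hb.
destruct (HM a b Ha Hb) as [J [HJ1 HJ2]]. exists J. split; [|exact HJ2].
now apply (RS_integral_ext f).
Qed.

Lemma RS_integral_R_poly s sigma n (c : nat -> R) : moment_solution s sigma ->
  RS_integral_R (fun x => rsum (fun i => c i * x ^ i) n) sigma
    (rsum (fun i => c i * s i) n).
Proof.
intros [_ H]. induction n as [|n IH]; simpl.
- pose proof (RS_integral_R_lin 0 0 _ _ _ _ _ (H O) (H O)) as H0.
  replace (0 * s O + 0 * s O) with 0 in H0 by ring.
  refine (RS_integral_R_ext _ _ _ _ _ H0). intros x. ring.
- pose proof (RS_integral_R_lin 1 (c n) _ _ _ _ _ IH (H n)) as Hn. cbv beta in Hn.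
  rewrite Rmult_1_l in Hn. refine (RS_integral_R_ext _ _ _ _ _ Hn). intros x. ring.
Qed.

(** A cell containing [t] is tagged at [t] itself. For a minorant, nonpositive only from [t] on,
    this controls the cell straddling [t]. *)
Definition tag_at (t x y : R) : R :=
  if Rle_dec x t then if Rle_dec t y then t else x else x.

Lemma tag_at_bounds t x y : x < y -> x <= tag_at t x y <= y.
Proof. intros H. unfold tag_at. destruct Rle_dec; [destruct Rle_dec|]; lra. Qed.

Lemma RS_integral_ge_step f sigma a b t J : nondecreasing sigma -> a < t < b ->
  (forall x, 0 <= f x) -> (forall x, x <= t -> 1 <= f x) ->
  RS_integral f sigma a b J -> sigma t - sigma a <= J.
Proof.
intros Hs Ht Hf0 Hf1 HJ. apply le_epsilon. intros eps Heps.
destruct (HJ eps Heps) as [d [Hd HJd]].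
destruct (fine_partition a b (tag_at t) d) as [n [p [Hp Hm]]];
  [lra|exact Hd|apply tag_at_bounds|].
specialize (HJd _ _ _ Hp Hm). apply Rabs_def2 in HJd.
enough (sigma t - sigma a <= RS_sum f sigma n p (fun i => tag_at t (p i) (p (S i)))) by lra.
clear HJd. destruct Hp as [Ha [Hb [Hinc _]]].
(* Induction along the partition; [Rmin (p m) t] freezes the bound once [t] is passed. *)
assert (H : forall m, (m <= n)%nat ->
  sigma (Rmin (p m) t) - sigma a <= RS_sum f sigma m p (fun i => tag_at t (p i) (p (S i)))).
{ induction m as [|m IH]; intros Hmn.
  - rewrite Ha, Rmin_left by lra. unfold RS_sum. simpl. lra.
  - specialize (IH ltac:(lia)). specialize (Hinc m Hmn).
    unfold RS_sum in *. simpl rsum.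
    assert (Hmono : sigma (p m) <= sigma (p (S m))) by (apply Hs; lra).
    enough (sigma (Rmin (p (S m)) t) - sigma (Rmin (p m) t) <=
      f (tag_at t (p m) (p (S m))) * (sigma (p (S m)) - sigma (p m))) by lra.
    unfold tag_at. destruct (Rle_dec (p m) t) as [h|h].
    + rewrite (Rmin_left (p m)) by lra.
      assert (Hmin : sigma (Rmin (p (S m)) t) <= sigma (p (S m))) by (apply Hs, Rmin_l).
      assert (H1 : forall z, z <= t -> sigma (p (S m)) - sigma (p m) <=
        f z * (sigma (p (S m)) - sigma (p m))).
      { intros z Hz. specialize (Hf1 z Hz). nra. }
      destruct (Rle_dec t (p (S m))); specialize (H1 t (Rle_refl t)) as H2;
        specialize (H1 (p m) h); lra.
    + rewrite !Rmin_right by lra. specialize (Hf0 (p m)). nra. }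
specialize (H n (le_n n)). rewrite Hb, Rmin_right in H by lra. exact H.
Qed.

Lemma RS_integral_le_step f sigma a b t J : nondecreasing sigma -> a < t < b ->
  (forall x, f x <= 1) -> (forall x, t <= x -> f x <= 0) ->
  RS_integral f sigma a b J -> J <= sigma t - sigma a.
Proof.
intros Hs Ht Hf1 Hf0 HJ. apply le_epsilon. intros eps Heps.
destruct (HJ eps Heps) as [d [Hd HJd]].
destruct (fine_partition a b (tag_at t) d) as [n [p [Hp Hm]]];
  [lra|exact Hd|apply tag_at_bounds|].
specialize (HJd _ _ _ Hp Hm). apply Rabs_def2 in HJd.
enough (RS_sum f sigma n p (fun i => tag_at t (p i) (p (S i))) <= sigma t - sigma a) by lra.
clear HJd. destruct Hp as [Ha [Hb [Hinc _]]].
assert (H : forall m, (m <= n)%nat ->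
  RS_sum f sigma m p (fun i => tag_at t (p i) (p (S i))) <= sigma (Rmin (p m) t) - sigma a).
{ induction m as [|m IH]; intros Hmn.
  - rewrite Ha, Rmin_left by lra. unfold RS_sum. simpl. lra.
  - specialize (IH ltac:(lia)). specialize (Hinc m Hmn).
    unfold RS_sum in *. simpl rsum.
    assert (Hmono : sigma (p m) <= sigma (p (S m))) by (apply Hs; lra).
    enough (f (tag_at t (p m) (p (S m))) * (sigma (p (S m)) - sigma (p m)) <=
      sigma (Rmin (p (S m)) t) - sigma (Rmin (p m) t)) by lra.
    unfold tag_at. destruct (Rle_dec (p m) t) as [h|h].
    + rewrite (Rmin_left (p m)) by lra. destruct (Rle_dec t (p (S m))) as [h'|h'].
      * rewrite Rmin_right by lra. specialize (Hf0 t (Rle_refl t)).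
        assert (sigma (p m) <= sigma t) by now apply Hs. nra.
      * rewrite Rmin_left by lra. specialize (Hf1 (p m)). nra.
    + rewrite !Rmin_right by lra. specialize (Hf0 (p m) ltac:(lra)). nra. }
specialize (H n (le_n n)). rewrite Hb, Rmin_right in H by lra. exact H.
Qed.

(* In the first argument, [step_at _ x] is the indicator of the half-line up to [x]. *)
Definition step_at (w x : R) : R := if Rle_dec w x then 1 else 0.

Lemma step_at_cases w x y : x < y ->
  step_at w y - step_at w x = 0 \/ (step_at w y - step_at w x = 1 /\ x < w <= y).
Proof. intros H. unfold step_at. do 2 destruct Rle_dec; lra. Qed.

(** Only the cell with [p i < w <= p (S i)] has a nonzero increment, and its tag is within the mesh
    of [w]. The jump is already made at [w], hence [a < w] is strict. *)
Lemma RS_integral_step f w a b : continuity_pt f w -> a < w <= b ->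
  RS_integral f (step_at w) a b (f w).
Proof.
intros Hf Hw eps Heps.
destruct (Hf (eps / 2)) as [d [Hd Hfd]]; [lra|].
exists d. split; [exact Hd|]. intros n p t [Ha [Hb [Hinc Htag]]] Hm.
assert (Hd' : forall x, Rabs (x - w) < d -> Rabs (f x - f w) < eps / 2).
{ intros x Hx. destruct (Req_dec w x) as [<-|Hne].
  - rewrite Rminus_diag, Rabs_R0. lra.
  - apply Hfd. split; [split; [exact I|exact Hne]|exact Hx]. }
assert (H : forall m, (m <= n)%nat ->
  Rabs (RS_sum f (step_at w) m p t - f w * (step_at w (p m) - step_at w (p O)))
  <= eps / 2 * (step_at w (p m) - step_at w (p O))).
{ induction m as [|m IH]; intros Hmn.
  - unfold RS_sum. simpl. rewrite !Rminus_diag, !Rmult_0_r, Rminus_diag, Rabs_R0. lra.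
  - specialize (IH ltac:(lia)). unfold RS_sum in *. simpl rsum.
    specialize (Hinc m Hmn). specialize (Htag m Hmn). specialize (Hm m Hmn).
    destruct (step_at_cases w (p m) (p (S m)) Hinc) as [E|[E Hwp]].
    + rewrite E. replace (step_at w (p (S m))) with (step_at w (p m)) by lra.
      replace (_ + f (t m) * 0) with (rsum (fun i =>
        f (t i) * (step_at w (p (S i)) - step_at w (p i))) m) by ring. exact IH.
    + assert (Ht : Rabs (f (t m) - f w) < eps / 2) by (apply Hd', Rabs_def1; lra).
      rewrite E. replace (step_at w (p (S m))) with (step_at w (p m) + 1) by lra.
      apply Rabs_def2 in Ht. apply Rabs_le. unfold Rabs in IH. destruct Rcase_abs; lra. }
specialize (H n (le_n n)). rewrite Ha, Hb in H.
replace (step_at w b - step_at w a) with 1 in H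
  by (unfold step_at; do 2 destruct Rle_dec; lra).
rewrite !Rmult_1_r in H. lra.
Qed.

Lemma RS_integral_add f sigma tau c a b I J :
  RS_integral f sigma a b I -> RS_integral f tau a b J ->
  RS_integral f (fun x => sigma x + c * tau x) a b (I + c * J).
Proof.
intros Hs Ht eps Heps.
set (K := Rabs c + 1).
assert (HK : 0 < K) by (unfold K; pose proof (Rabs_pos c); lra).
assert (HeK : 0 < eps / K) by (apply Rdiv_lt_0_compat; lra).
destruct (Hs _ HeK) as [d1 [Hd1 H1]]. destruct (Ht _ HeK) as [d2 [Hd2 H2]].
exists (Rmin d1 d2). split; [now apply Rmin_glb_lt|].
intros n p t Hp Hm.
assert (Hm1 : mesh_lt n p d1).
{ intros i Hi. specialize (Hm i Hi). pose proof (Rmin_l d1 d2). lra. }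
assert (Hm2 : mesh_lt n p d2).
{ intros i Hi. specialize (Hm i Hi). pose proof (Rmin_r d1 d2). lra. }
specialize (H1 n p t Hp Hm1). specialize (H2 n p t Hp Hm2).
replace (RS_sum f (fun x => sigma x + c * tau x) n p t)
  with (1 * RS_sum f sigma n p t + c * RS_sum f tau n p t).
2:{ unfold RS_sum. rewrite <- rsum_lin. apply rsum_ext. intros i. ring. }
replace (1 * RS_sum f sigma n p t + c * RS_sum f tau n p t - (I + c * J))
  with ((RS_sum f sigma n p t - I) + c * (RS_sum f tau n p t - J)) by ring.
apply Rle_lt_trans with (1 := Rabs_triang _ _). rewrite !Rabs_mult.
replace eps with (K * (eps / K)) by (field; lra). unfold K at 1.
pose proof (Rabs_pos c). nra.
Qed.

Lemma moment_solution_add_atom s sigma c w : 0 <= c ->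
  moment_solution (fun k => s k - c * w ^ k) sigma ->
  moment_solution s (fun x => sigma x + c * step_at w x).
Proof.
intros Hc [Hmono Hmom]. split.
- intros x y Hxy. specialize (Hmono x y Hxy).
  assert (step_at w x <= step_at w y) by (unfold step_at; do 2 destruct Rle_dec; lra).
  nra.
- intros k eps Heps. destruct (Hmom k eps Heps) as [M HM].
  (* The window is enlarged to contain the atom. *)
  exists (Rmax M (Rabs w + 1)). intros a b Ha Hb.
  pose proof (Rmax_l M (Rabs w + 1)). pose proof (Rmax_r M (Rabs w + 1)).
  destruct (HM a b) as [J [HJ1 HJ2]]; [lra|lra|].
  exists (J + c * w ^ k). split.
  + apply RS_integral_add; [exact HJ1|]. apply (RS_integral_step (fun x => x ^ k)).
    * apply derivable_continuous_pt, derivable_pt_pow.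
    * pose proof (Rle_abs w). pose proof (Rle_abs (- w)). rewrite Rabs_Ropp in *. lra.
  + now replace (J + c * w ^ k - s k) with (J - (s k - c * w ^ k)) by ring.
Qed.

(** * Continuity points of monotone functions *)

(** Nested intervals: one of the two halves carries at most half of the increase of [G]. Its middle
    third is kept, so that the limit point is interior to every interval. *)
Lemma nondecreasing_continuity_point (G : R -> R) x y :
  nondecreasing G -> x < y -> exists z, x < z < y /\
   forall eps, 0 < eps -> exists delta, 0 < delta /\
     forall z', Rabs (z' - z) < delta -> Rabs (G z' - G z) < eps.
Proof.
intros HG Hxy.
pose (step := fun q : R * R => let (l, u) := q in let m := (l + u) / 2 in
  if Rle_dec (G m - G l) ((G u - G l) / 2)
  then (l + (m - l) / 3, m - (m - l) / 3) else (m + (u - m) / 3, u - (u - m) / 3)).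
pose (q := fun n => Nat.iter n step (x, y)).
assert (Hq : forall n, fst (q n) < snd (q n)).
{ induction n as [|n IH]; [exact Hxy|]. change (q (S n)) with (step (q n)).
  destruct (q n) as [l u]; simpl in *. destruct Rle_dec; simpl; lra. }
assert (Hs : forall n, fst (q n) < fst (q (S n)) /\ snd (q (S n)) < snd (q n)).
{ intros n. specialize (Hq n). change (q (S n)) with (step (q n)).
  destruct (q n) as [l u]; simpl in *. destruct Rle_dec; simpl; lra. }
assert (Ho : forall n, G (snd (q n)) - G (fst (q n)) <= (G y - G x) / 2 ^ n).
{ induction n as [|n IH]; [simpl; lra|]. specialize (Hq n).
  change (q (S n)) with (step (q n)).
  replace ((G y - G x) / 2 ^ S n) with ((G y - G x) / 2 ^ n / 2)
    by (simpl; field; apply pow_nonzero; lra).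
  destruct (q n) as [l u]; simpl in *.
  destruct Rle_dec as [h|h]; simpl.
  - assert (G l <= G (l + ((l + u) / 2 - l) / 3)) by (apply HG; lra).
    assert (G ((l + u) / 2 - ((l + u) / 2 - l) / 3) <= G ((l + u) / 2)) by (apply HG; lra).
    lra.
  - assert (G ((l + u) / 2) <= G ((l + u) / 2 + (u - (l + u) / 2) / 3)) by (apply HG; lra).
    assert (G (u - (u - (l + u) / 2) / 3) <= G u) by (apply HG; lra).
    lra. }
assert (Hl : forall n m, (n <= m)%nat -> fst (q n) <= fst (q m) /\ snd (q m) <= snd (q n)).
{ intros n m Hnm. induction Hnm as [|m Hnm IH]; [lra|]. specialize (Hs m). lra. }
assert (Hlu : forall n m, fst (q n) < snd (q m)).
{ intros n m. destruct (Nat.le_ge_cases n m) as [h|h].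
  - specialize (Hl n m h). specialize (Hq m). lra.
  - specialize (Hl m n h). specialize (Hq n). lra. }
destruct (completeness (fun r => exists n, r = fst (q n))) as [z [Hz1 Hz2]].
{ exists (snd (q O)). intros r [n ->]. left. apply Hlu. }
{ exists (fst (q O)). now exists O. }
assert (Hz : forall n, fst (q n) < z < snd (q n)).
{ intros n. split.
  - specialize (Hz1 (fst (q (S n))) (ex_intro _ (S n) eq_refl)). specialize (Hs n). lra.
  - assert (z <= snd (q (S n))).
    { apply Hz2. intros r [m ->]. left. apply Hlu. }
    specialize (Hs n). lra. }
exists z. split; [exact (Hz O)|]. intros eps Heps.
assert (HGxy : G x <= G y) by (apply HG; lra).
destruct (pow_lt_1_zero (/ 2)) with (y := eps / (G y - G x + 1)) as [N HN].
{ rewrite Rabs_pos_eq; lra. }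
{ apply Rdiv_lt_0_compat; lra. }
specialize (HN N (le_n N)). specialize (Hz N). specialize (Ho N).
assert (Hsm : (G y - G x) / 2 ^ N < eps).
{ rewrite Rabs_pos_eq in HN by (apply pow_le; lra).
  rewrite pow_inv in HN. unfold Rdiv.
  assert (H2 : 0 < / 2 ^ N) by (apply Rinv_0_lt_compat, pow_lt; lra).
  apply Rle_lt_trans with ((G y - G x + 1) * / 2 ^ N); [nra|].
  apply (Rmult_lt_compat_l (G y - G x + 1)) in HN; [|lra].
  replace ((G y - G x + 1) * (eps / (G y - G x + 1))) with eps in HN by (field; lra).
  exact HN. }
exists (Rmin (z - fst (q N)) (snd (q N) - z)). split.
{ apply Rmin_glb_lt; lra. }
intros z' Hz'.
pose proof (Rmin_l (z - fst (q N)) (snd (q N) - z)).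
pose proof (Rmin_r (z - fst (q N)) (snd (q N) - z)).
apply Rabs_def2 in Hz'.
assert (G (fst (q N)) <= G z') by (apply HG; lra).
assert (G z' <= G (snd (q N))) by (apply HG; lra).
assert (G (fst (q N)) <= G z) by (apply HG; lra).
assert (G z <= G (snd (q N))) by (apply HG; lra).
apply Rabs_def1; lra.
Qed.

(** The increments of [G1 + G2] dominate those of [G1 - G2] in absolute value. *)
Lemma common_continuity_point (G1 G2 : R -> R) x y :
  nondecreasing G1 -> nondecreasing G2 -> x < y ->
  exists z, x < z < y /\ continuity_pt (fun u => G1 u - G2 u) z.
Proof.
intros H1 H2 Hxy.
destruct (nondecreasing_continuity_point (fun u => G1 u + G2 u) x y) as [z [Hz Hc]]; auto.
{ intros u v Huv. specialize (H1 u v Huv). specialize (H2 u v Huv). lra. }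
exists z. split; [exact Hz|].
intros eps Heps. destruct (Hc eps Heps) as [delta [Hd Hdelta]].
exists delta. split; [exact Hd|]. intros u [_ Hu]. simpl in *. unfold Rdist in *.
specialize (Hdelta u Hu). apply Rabs_def2 in Hdelta.
destruct (Rle_dec u z) as [h|h].
- specialize (H1 u z h). specialize (H2 u z h). apply Rabs_def1; lra.
- assert (h' : z <= u) by lra.
  specialize (H1 z u h'). specialize (H2 z u h'). apply Rabs_def1; lra.
Qed.

(** * Hamburger's theorem *)

Lemma Rabs_le_bounds x y : Rabs x <= y -> - y <= x <= y.
Proof. unfold Rabs. destruct Rcase_abs; lra. Qed.

Theorem hamburger (s : nat -> R) : positive_seq s -> exists sigma, moment_solution s sigma.
Proof.
intros Hpos. destruct (moment_functional Hpos) as [Lam [LD LZ L0 Ls]].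
assert (GB : forall f K, (forall x, Rabs (f x) <= K) -> poly_growth f).
{ intros f K Hf. apply (@poly_growth_dom (K / 2) 0). intros x. specialize (Hf x). simpl. lra. }
assert (GP : forall k f, (forall x, Rabs (f x) <= Rabs (x ^ k)) -> poly_growth f).
{ intros k f Hf. apply (@poly_growth_dom 1 (k * 2)). intros x.
  apply Rle_trans with (1 := Hf x). rewrite pow_mult. unfold Rabs.
  destruct Rcase_abs; nra. }
assert (GI : forall x, poly_growth (fun y => step_at y x)).
{ intros x. apply (GB _ 1). intros y. unfold step_at.
  destruct Rle_dec; rewrite Rabs_pos_eq; lra. }
assert (LL : forall a b f g, poly_growth f -> poly_growth g ->
  poly_growth (fun x => a * f x + b * g x) /\
  Lam (fun x => a * f x + b * g x) = a * Lam f + b * Lam g).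
{ intros a b f g Hf Hg. split.
  - apply poly_growthD; now apply poly_growthZ.
  - rewrite LD by now apply poly_growthZ. now rewrite !LZ. }
assert (Lle : forall f g, poly_growth f -> poly_growth g ->
  (forall x, f x <= g x) -> Lam f <= Lam g).
{ intros f g Hf Hg Hfg. destruct (LL 1 (-1) g f Hg Hf) as [G E].
  enough (0 <= Lam (fun x => 1 * g x + -1 * f x)) by lra.
  apply L0; [exact G|]. intros x. specialize (Hfg x). lra. }
pose (sigma := fun x => Lam (fun y => step_at y x)).
assert (Hmono : nondecreasing sigma).
{ intros x y Hxy. apply Lle; auto. intros z. unfold step_at. do 2 destruct Rle_dec; lra. }
assert (G1 : poly_growth (fun y => y ^ 0)) by apply poly_growth_pow.
assert (Hbd : forall a b, sigma b - sigma a <= s O).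
{ intros a b. rewrite <- Ls. destruct (LL 1 (-1) _ _ (GI b) (GI a)) as [G E].
  unfold sigma. replace (Lam (fun y => step_at y b) - Lam (fun y => step_at y a))
    with (Lam (fun y => 1 * step_at y b + -1 * step_at y a)) by (rewrite E; ring).
  apply Lle; [exact G|exact G1|]. intros y. unfold step_at. simpl.
  do 2 destruct Rle_dec; lra. }
(* The power restricted to []a, b]]; [Lam] of it will be the integral over [[a, b]]. *)
pose (cut := fun k a b y => y ^ k * (step_at y b - step_at y a)).
assert (Gcut : forall k a b, poly_growth (cut k a b)).
{ intros k a b. apply (GP k). intros y. unfold cut, step_at.
  rewrite Rabs_mult. pose proof (Rabs_pos (y ^ k)).
  do 2 destruct Rle_dec; match goal with |- context [Rabs (?u - ?v)] =>
    assert (Rabs (u - v) <= 1) by (apply Rabs_le; lra) end; nra. }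
exists sigma. split; [exact Hmono|]. intros k eps Heps.
assert (Hs0 : 0 <= s O).
{ rewrite <- Ls. apply L0; [exact G1|]. intros x. simpl. lra. }
assert (Hs2 : 0 <= s (2 * (k + 1))%nat).
{ rewrite <- Ls. apply L0; [apply poly_growth_pow|]. intros x. rewrite pow_mult.
  apply pow_le. nra. }
set (m2 := s (2 * (k + 1))%nat) in *.
assert (Hq : 0 <= m2 / eps) by (apply Rle_mult_inv_pos; lra).
(* With [M] this number, [|y|^k <= y^(2 k + 2) / M] for [|y| >= M], so the tails cost at most
   [m2 / M < eps]; the summand [1] gives [M >= 1], needed to compare the powers. *)
exists (m2 / eps + 1). intros a b Ha Hb.
exists (Lam (cut k a b)). split.
- intros e He.
  (* [s O] bounds the total increase of [sigma]; the added [1] keeps the denominator positive and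
     the final bound strict. *)
  assert (He' : 0 < e / (s O + 1)) by (apply Rdiv_lt_0_compat; lra).
  destruct (Heine_cor2 (f := fun x => x ^ k) (a := a) (b := b)
    (fun x _ => derivable_continuous_pt _ _ (derivable_pt_pow k x))
    (mkposreal _ He')) as [d Hd]. simpl in Hd.
  exists d. split; [apply cond_pos|]. intros n p t Hp Hm.
  (* A Riemann-Stieltjes sum is [Lam] of a step function [g], uniformly close to [cut] on the cells
     and equal to it elsewhere. *)
  assert (Hsum : forall m, (m <= n)%nat -> exists g, poly_growth g /\
    Lam g = RS_sum (fun x => x ^ k) sigma m p t /\
    forall y, Rabs (cut k (p O) (p m) y - g y) <=
      e / (s O + 1) * (step_at y (p m) - step_at y (p O))).
  { induction m as [|m IH]; intros Hmn.
    (* The zero function, written as a combination so that linearity evaluates [Lam] on it. *)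
    - exists (fun y => 0 * step_at y 0 + 0 * step_at y 0).
      destruct (LL 0 0 _ _ (GI 0) (GI 0)) as [G E].
      split; [exact G|]. split; [rewrite E; unfold RS_sum; simpl; ring|].
      intros y. unfold cut. rewrite !Rminus_diag, !Rmult_0_r.
      rewrite Rabs_pos_eq; lra.
    - destruct (IH ltac:(lia)) as [g [Gg [Eg Hg]]].
      destruct (LL 1 (-1) _ _ (GI (p (S m))) (GI (p m))) as [G E].
      destruct (LL 1 (t m ^ k) _ _ Gg G) as [G' E'].
      exists (fun y => 1 * g y + t m ^ k * (1 * step_at y (p (S m)) + -1 * step_at y (p m))).
      split; [exact G'|]. split.
      { rewrite E', E, Eg. unfold RS_sum. simpl rsum. unfold sigma. ring. }
      intros y. specialize (Hg y).
      assert (Hin : forall i, (i <= n)%nat -> a <= p i <= b)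
        by (intros i Hi; exact (partition_bounds _ _ _ _ _ _ Hp Hi)).
      destruct Hp as [_ [_ [Hinc Htag]]].
      specialize (Hinc m Hmn). specialize (Htag m Hmn). specialize (Hm m Hmn).
      assert (Hterm : Rabs ((y ^ k - t m ^ k) * (step_at y (p (S m)) - step_at y (p m)))
        <= e / (s O + 1) * (step_at y (p (S m)) - step_at y (p m))).
      { destruct (step_at_cases y (p m) (p (S m)) Hinc) as [E0|[E0 Hy]].
        - rewrite E0, !Rmult_0_r, Rabs_R0. lra.
        - rewrite E0, !Rmult_1_r. left.
          pose proof (Hin m ltac:(lia)). pose proof (Hin (S m) Hmn).
          apply Hd; [lra|lra|]. apply Rabs_def1; lra. }
      replace (cut k (p O) (p (S m)) y - _) with
        ((cut k (p O) (p m) y - g y) +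
         (y ^ k - t m ^ k) * (step_at y (p (S m)) - step_at y (p m)))
        by (unfold cut; ring).
      apply Rle_trans with (1 := Rabs_triang _ _). lra. }
  destruct (Hsum n (le_n n)) as [g [Gg [Eg Hg]]].
  destruct Hp as [Hp0 [Hpn _]]. rewrite Hp0, Hpn in Hg.
  destruct (LL 1 (-1) _ _ (GI b) (GI a)) as [Gd Ed].
  destruct (LL (e / (s O + 1)) 0 _ _ Gd G1) as [Ge Ee].
  destruct (LL 1 (-1) _ _ (Gcut k a b) Gg) as [Gx Ex].
  destruct (LL 1 (-1) _ _ Gg (Gcut k a b)) as [Gy Ey].
  assert (B1 := Lle _ _ Gx Ge). assert (B2 := Lle _ _ Gy Ge).
  rewrite Ex, Ee, Ed in B1. rewrite Ey, Ee, Ed in B2. rewrite <- Eg.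
  fold (sigma b) (sigma a) in B1, B2.
  assert (Hle : e / (s O + 1) * (sigma b - sigma a) < e).
  { apply Rle_lt_trans with (e / (s O + 1) * s O).
    - apply Rmult_le_compat_l; [lra|apply Hbd].
    - apply Rlt_le_trans with (e / (s O + 1) * (s O + 1)); [nra|]. right. field. lra. }
  apply Rabs_def1.
  + enough (1 * Lam g + -1 * Lam (cut k a b) <=
      e / (s O + 1) * (1 * sigma b + -1 * sigma a) + 0 * Lam (fun y => y ^ 0)) by lra.
    apply B2. intros x. specialize (Hg x). apply Rabs_le_bounds in Hg. lra.
  + enough (1 * Lam (cut k a b) + -1 * Lam g <=
      e / (s O + 1) * (1 * sigma b + -1 * sigma a) + 0 * Lam (fun y => y ^ 0)) by lra.
    apply B1. intros x. specialize (Hg x). apply Rabs_le_bounds in Hg. lra.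
- set (M := m2 / eps + 1) in *.
  assert (HM1 : 1 <= M) by (unfold M; lra).
  assert (HM : m2 < eps * M) by (unfold M; field_simplify; lra).
  assert (Hpt : forall y, Rabs (cut k a b y - y ^ k) <= / M * y ^ (2 * (k + 1))).
  { intros y. assert (Hy2 : 0 <= y ^ (2 * (k + 1))) by (rewrite pow_mult; apply pow_le; nra).
    assert (HM0 : 0 < / M) by (apply Rinv_0_lt_compat; unfold M; lra).
    assert (HMy : M <= Rabs y -> Rabs (y ^ k) <= / M * y ^ (2 * (k + 1))).
    { intros Hy. apply (Rmult_le_reg_l M); [unfold M; lra|].
      replace (M * (/ M * y ^ (2 * (k + 1)))) with (y ^ (2 * (k + 1)))
        by (field; unfold M; lra).
      rewrite <- (Rabs_pos_eq _ Hy2), <- !RPow_abs.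
      replace (2 * (k + 1))%nat with (S (2 * k + 1)) by lia. simpl pow at 2.
      assert (1 <= Rabs y) by (unfold M in Hy; lra).
      apply Rmult_le_compat; [unfold M; lra|apply pow_le; lra|exact Hy|].
      apply Rle_pow; [lra|lia]. }
    assert (H0 : 0 <= / M * y ^ (2 * (k + 1))) by (apply Rmult_le_pos; lra).
    unfold cut, step_at. destruct (Rle_dec y b) as [h|h]; destruct (Rle_dec y a) as [h'|h'].
    - replace (y ^ k * (1 - 1) - y ^ k) with (- y ^ k) by ring. rewrite Rabs_Ropp.
      apply HMy. rewrite <- Rabs_Ropp. pose proof (Rle_abs (- y)). lra.
    - replace (y ^ k * (1 - 0) - y ^ k) with 0 by ring. now rewrite Rabs_R0.
    - exfalso. lra.
    - replace (y ^ k * (0 - 0) - y ^ k) with (- y ^ k) by ring. rewrite Rabs_Ropp.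
      apply HMy. pose proof (Rle_abs y). lra. }
  assert (Gk := poly_growth_pow k). assert (G2 := poly_growth_pow (2 * (k + 1))).
  destruct (LL (/ M) 0 _ _ G2 G1) as [Ge Ee].
  destruct (LL 1 (-1) _ _ (Gcut k a b) Gk) as [Gx Ex].
  destruct (LL 1 (-1) _ _ Gk (Gcut k a b)) as [Gy Ey].
  assert (B1 := Lle _ _ Gx Ge). assert (B2 := Lle _ _ Gy Ge).
  rewrite Ex, Ee, !Ls in B1. rewrite Ey, Ee, !Ls in B2. fold m2 in B1, B2.
  assert (Hlt : / M * m2 < eps).
  { apply (Rmult_lt_reg_l M); [unfold M; lra|].
    replace (M * (/ M * m2)) with m2 by (field; unfold M; lra). lra. }
  apply Rabs_def1.
  + enough (1 * Lam (cut k a b) + -1 * s k <= / M * m2 + 0 * s O) by lra.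
    apply B1. intros x. specialize (Hpt x). apply Rabs_le_bounds in Hpt. lra.
  + enough (1 * s k + -1 * Lam (cut k a b) <= / M * m2 + 0 * s O) by lra.
    apply B2. intros x. specialize (Hpt x). apply Rabs_le_bounds in Hpt. lra.
Qed.

(** * Indeterminacy of the subsequence *)

Lemma moment_solution_poly s sigma f I : moment_solution s sigma ->
  poly_moment s f I -> RS_integral_R f sigma I.
Proof.
intros Hs [n [c [Hf ->]]].
refine (RS_integral_R_ext _ _ _ _ _ (RS_integral_R_poly _ _ n c Hs)).
intros x. now rewrite Hf.
Qed.

(* [evaluation_unbounded_step] squeezes the step at [t] between two polynomials whose
   moments differ by less than [c]; integrate one against [s1], the other against [s2]. *)
Lemma solutions_close_one_sided s s1 s2 c t : positive_seq s ->
  moment_solution s s1 -> moment_solution s s2 -> ~ evaluation_bounded s c t ->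
  exists M, forall a, a <= - M -> (s1 t - s2 t) - (s1 a - s2 a) < c.
Proof.
intros Hpos H1 H2 Hub.
destruct (evaluation_unbounded_step Hpos Hub)
  as [U [V [u [v [[HU HV Huv] [U0 U1 V1 V0]]]]]].
(* Half of the slack in [u - v < c] for each integral. *)
assert (He : 0 < (c - (u - v)) / 2) by lra.
destruct (moment_solution_poly _ _ _ _ H1 HU _ He) as [M1 HM1].
destruct (moment_solution_poly _ _ _ _ H2 HV _ He) as [M2 HM2].
exists (Rmax (Rmax M1 M2) (Rabs t + 1)). intros a Ha.
set (M := Rmax (Rmax M1 M2) (Rabs t + 1)) in *.
assert (B1 : M1 <= M) by (eapply Rle_trans; [apply Rmax_l|apply Rmax_l]).
assert (B2 : M2 <= M) by (eapply Rle_trans; [apply Rmax_r|apply Rmax_l]).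
assert (B3 : Rabs t + 1 <= M) by apply Rmax_r.
pose proof (Rabs_le_bounds t (Rabs t) (Rle_refl _)) as Ht.
destruct (HM1 a M) as [J1 [HJ1 HJ1']]; [lra|lra|].
destruct (HM2 a M) as [J2 [HJ2 HJ2']]; [lra|lra|].
assert (s1 t - s1 a <= J1).
{ apply (RS_integral_ge_step U s1 a M t J1); auto; [apply H1|lra]. }
assert (J2 <= s2 t - s2 a).
{ apply (RS_integral_le_step V s2 a M t J2); auto; [apply H2|lra]. }
apply Rabs_def2 in HJ1'. apply Rabs_def2 in HJ2'. lra.
Qed.

(** Subtracting values at a point [a] far to the left normalises the solutions, which are only fixed
    up to constants; exchanging [s1] and [s2] gives the other side. *)
Lemma solutions_close s s1 s2 c t : positive_seq s ->
  moment_solution s s1 -> moment_solution s s2 -> ~ evaluation_bounded s c t ->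
  exists M, forall a, a <= - M -> Rabs ((s1 t - s2 t) - (s1 a - s2 a)) < c.
Proof.
intros Hpos H1 H2 Hub.
destruct (solutions_close_one_sided s s1 s2 c t Hpos H1 H2 Hub) as [M1 HM1].
destruct (solutions_close_one_sided s s2 s1 c t Hpos H2 H1 Hub) as [M2 HM2].
exists (Rmax M1 M2). intros a Ha.
pose proof (Rmax_l M1 M2). pose proof (Rmax_r M1 M2).
specialize (HM1 a ltac:(lra)). specialize (HM2 a ltac:(lra)). apply Rabs_def1; lra.
Qed.

(** Let [x0], [x1] be continuity points of [s1 - s2] with different values. If the bound failed both
    somewhere near [x0] and somewhere near [x1], both values would be close to the one at a common
    point far to the left. *)
Lemma evaluation_bounded_interval s s1 s2 : positive_seq s ->
  moment_solution s s1 -> moment_solution s s2 -> ~ same_solution s1 s2 ->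
  exists c x r, 0 < c /\ 0 < r /\
    forall u, Rabs (u - x) < r -> evaluation_bounded s c u.
Proof.
intros Hpos H1 H2 Hns.
pose (D := fun y => s1 y - s2 y).
destruct (classic (exists x0, continuity_pt D x0)) as [[x0 Hx0]|Hno].
(* Without continuity points, [same_solution] holds vacuously. *)
2:{ exfalso. apply Hns. exists 0. intros x Hx. exfalso. apply Hno. now exists x. }
assert (Hx1 : exists x1, continuity_pt D x1 /\ D x1 <> D x0).
{ apply NNPP. intros Hno. apply Hns. exists (D x0). intros x Hx.
  apply NNPP. intros Hne. apply Hno. now exists x. }
destruct Hx1 as [x1 [Hx1 Hne]].
(* A quarter: two errors come from continuity and two from [solutions_close]. *)
set (eta := Rabs (D x1 - D x0) / 4).
assert (Heta : 0 < eta).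
{ unfold eta. assert (0 < Rabs (D x1 - D x0)) by (apply Rabs_pos_lt; lra). lra. }
assert (Hnear : forall x, continuity_pt D x -> exists r, 0 < r /\
  forall u, Rabs (u - x) < r -> Rabs (D u - D x) < eta).
{ intros x Hx. destruct (Hx eta Heta) as [r [Hr Hd]]. exists r. split; [exact Hr|].
  intros u Hu. destruct (Req_dec x u) as [<-|Hxu].
  - rewrite Rminus_diag, Rabs_R0. exact Heta.
  - apply Hd. split; [split; [exact I|exact Hxu]|exact Hu]. }
destruct (Hnear x0 Hx0) as [r0 [Hr0 Hd0]]. destruct (Hnear x1 Hx1) as [r1 [Hr1 Hd1]].
destruct (classic (forall u, Rabs (u - x0) < r0 -> evaluation_bounded s eta u)) as [Hall|Hex].
{ now exists eta, x0, r0. }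
exists eta, x1, r1. split; [exact Heta|]. split; [exact Hr1|]. intros v Hv.
apply NNPP. intros Hnv. apply not_all_ex_not in Hex. destruct Hex as [u Hu].
apply imply_to_and in Hu. destruct Hu as [Hu Hnu].
destruct (solutions_close s s1 s2 eta u Hpos H1 H2 Hnu) as [M0 HM0].
destruct (solutions_close s s1 s2 eta v Hpos H1 H2 Hnv) as [M1 HM1].
pose proof (Rmax_l M0 M1). pose proof (Rmax_r M0 M1).
specialize (HM0 (- Rmax M0 M1) ltac:(lra)). specialize (HM1 (- Rmax M0 M1) ltac:(lra)).
specialize (Hd0 u Hu). specialize (Hd1 v Hv).
fold (D u) (D (- Rmax M0 M1)) in HM0. fold (D v) (D (- Rmax M0 M1)) in HM1.
set (z := D (- Rmax M0 M1)) in *.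
apply Rabs_def2 in HM0. apply Rabs_def2 in HM1.
apply Rabs_def2 in Hd0. apply Rabs_def2 in Hd1.
assert (Rabs (D x1 - D x0) < 4 * eta) by (apply Rabs_def1; lra).
unfold eta in *. lra.
Qed.

(* Subtracting an atom of mass [c] at [w] keeps the sequence positive, so the unique
   solution jumps by at least [c] at every [w]. *)
Lemma determinate_evaluation_unbounded s c A B : determinate s -> 0 < c -> A < B ->
  ~ (forall w, A < w < B -> evaluation_bounded s c w).
Proof.
intros [Hpos [[sigma Hsig] Huniq]] Hc HAB Hall.
assert (Hjump : forall x w y, A < w < B -> x < w < y -> c <= sigma y - sigma x).
{ intros x w y Hw Hxy.
  destruct (hamburger _ (positive_sub_atom (Hall w Hw))) as [tau Htau].
  (* With the atom put back, [tau] solves the problem for [s], so it agrees with [sigma] up to a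
     constant at continuity points of the difference; such points exist on both sides of [w]. *)
  assert (Ht : moment_solution s (fun x => tau x + c * step_at w x))
    by (apply moment_solution_add_atom; [lra|exact Htau]).
  destruct (Huniq _ _ Hsig Ht) as [C0 HC0].
  destruct (common_continuity_point sigma (fun x => tau x + c * step_at w x) x w)
    as [x' [Hx' Cx]]; [apply Hsig|apply Ht|lra|].
  destruct (common_continuity_point sigma (fun x => tau x + c * step_at w x) w y)
    as [y' [Hy' Cy]]; [apply Hsig|apply Ht|lra|].
  apply HC0 in Cx. apply HC0 in Cy. simpl in Cx, Cy.
  assert (sigma x <= sigma x') by (apply Hsig; lra).
  assert (sigma y' <= sigma y) by (apply Hsig; lra).
  assert (tau x' <= tau y') by (apply Htau; lra).
  unfold step_at in *. destruct (Rle_dec w x'); [lra|]. destruct (Rle_dec w y'); lra. }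
(* Cut [[A, B]] into [N] equal parts: an increase of at least [c] on each exceeds the total increase
   of [sigma]. *)
destruct (INR_unbounded ((sigma B - sigma A) / c)) as [N HN].
assert (HAB' : sigma A <= sigma B) by (apply Hsig; lra).
assert (HN0 : 0 < INR N).
{ apply Rle_lt_trans with (2 := HN). apply Rle_mult_inv_pos; lra. }
set (h := (B - A) / INR N).
assert (Hh : 0 < h) by (apply Rdiv_lt_0_compat; lra).
assert (HB : A + INR N * h = B) by (unfold h; field; lra).
assert (Hind : forall i, (i <= N)%nat -> INR i * c <= sigma (A + INR i * h) - sigma A).
{ induction i as [|i IH]; intros Hi.
  - simpl. replace (A + 0 * h) with A by ring. lra.
  - specialize (IH ltac:(lia)).
    assert (HiN : INR (S i) <= INR N) by now apply le_INR.
    rewrite S_INR in *. pose proof (pos_INR i).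
    enough (c <= sigma (A + (INR i + 1) * h) - sigma (A + INR i * h)) by lra.
    apply (Hjump _ (A + (INR i + / 2) * h)); nra. }
specialize (Hind N (le_n N)). rewrite HB in Hind.
apply (Rmult_lt_compat_r c) in HN; [|exact Hc].
replace ((sigma B - sigma A) / c * c) with (sigma B - sigma A) in HN by (field; lra).
lra.
Qed.

Lemma pow_surjective d u v w : u < v -> u ^ d < w < v ^ d ->
  exists r, u <= r <= v /\ r ^ d = w.
Proof.
intros Huv Hw.
destruct (IVT (fun x => x ^ d - w) u v) as [r [Hr Er]]; [|lra|lra|lra|].
- apply continuity_minus; [|apply continuity_const; now intros x y].
  intros x. apply derivable_continuous_pt, derivable_pt_pow.
- exists r. split; [exact Hr|lra].
Qed.

Theorem mainTheorem5 (s : nat -> R) (d l0 : nat) :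
  positive_seq s -> (1 <= d)%nat -> Nat.Even l0 ->
  indeterminate s -> indeterminate (fun k => s (k * d + l0)%nat).
Proof.
intros Hpos Hd Hl [_ Hndet]. split; [exact (positive_subseq d Hpos Hl)|].
(* A solution exists by Hamburger's theorem, so it is uniqueness that fails for [s]. *)
intros Hdet. apply Hndet. split; [exact Hpos|]. split; [now apply hamburger|].
intros s1 s2 H1 H2. apply NNPP. intros Hns.
destruct (evaluation_bounded_interval s s1 s2 Hpos H1 H2 Hns)
  as [c [x [r [Hc [Hr Hball]]]]].
(* A part of the ball away from [0] and on one side of it, written with a sign [e]: there [|t|^l0]
   has a positive lower bound and [t^d] is strictly monotone. *)
assert (Hsgn : exists e u v, (e = 1 \/ e = -1) /\ 0 < u < v /\
  forall y, u <= y <= v -> evaluation_bounded s c (e * y)).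
{ destruct (Rle_dec 0 x) as [h|h].
  - exists 1, (x + r / 3), (x + r / 2). split; [now left|]. split; [lra|].
    intros y Hy. apply Hball. apply Rabs_def1; lra.
  - exists (-1), (- x + r / 3), (- x + r / 2). split; [now right|]. split; [lra|].
    intros y Hy. apply Hball. apply Rabs_def1; lra. }
destruct Hsgn as [e [u [v [He [Huv Hev]]]]].
(* The least value of [c t^l0] on that part; [l0] being even, the sign [e] disappears. *)
set (c' := c * u ^ l0).
assert (Hc' : 0 < c') by (apply Rmult_lt_0_compat; [exact Hc|apply pow_lt; lra]).
assert (Hsub : forall y, u <= y <= v ->
  evaluation_bounded (fun k => s (k * d + l0)%nat) c' (e ^ d * y ^ d)).
{ intros y Hy. rewrite <- Rpow_mult_distr.
  apply (@evaluation_bounded_le _ (c * (e * y) ^ l0)).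
  - unfold c'. apply Rmult_le_compat_l; [lra|]. rewrite Rpow_mult_distr.
    replace (e ^ l0) with 1.
    + rewrite Rmult_1_l. apply pow_incr. lra.
    + destruct Hl as [m ->]. rewrite pow_mult.
      replace (e ^ 2) with 1 by (destruct He as [-> | ->]; ring). now rewrite pow1.
  - apply evaluation_bounded_subseq; [exact Hl|]. now apply Hev. }
assert (Hpow : u ^ d < v ^ d).
{ clear - Huv Hd. induction Hd as [|d _ IH]; [simpl; lra|]. simpl.
  apply Rmult_gt_0_lt_compat; [apply pow_lt; lra|lra|lra|exact IH]. }
assert (Hed : e ^ d = 1 \/ e ^ d = -1).
{ destruct He as [-> | ->]; [left; apply pow1|].
  clear. induction d as [|d IH]; simpl; [now left|].
  destruct IH as [-> | ->]; [right|left]; ring. }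
destruct Hed as [E|E]; rewrite E in Hsub.
- refine (determinate_evaluation_unbounded _ c' (u ^ d) (v ^ d) Hdet Hc' Hpow _).
  intros w Hw. destruct (pow_surjective d u v w) as [y [Hy <-]]; [lra|lra|].
  rewrite <- (Rmult_1_l (y ^ d)). now apply Hsub.
(* Here the points [t^d] are negative and fill the reflected interval. *)
- refine (determinate_evaluation_unbounded _ c' (- v ^ d) (- u ^ d) Hdet Hc' _ _); [lra|].
  intros w Hw. destruct (pow_surjective d u v (- w)) as [y [Hy Ey]]; [lra|lra|].
  replace w with (-1 * y ^ d) by lra. now apply Hsub.
Qed.
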